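(* (i) Let $\mathcal{A}$ be a matrix ordered $*$-algebra with unit $e$, with cones $C_n\subseteq M_n(\mathcal{A})_{sa}$ ($n\ge 1$), and suppose that $e$ is an Archimedean matrix order unit. Then there exist a Hilbert space $H$ and a faithful (injective) unital $*$-representation $\tau:\mathcal{A}\to B(H)$ such that $\tau^{(n)}(C_n)=M_n(\tau(\mathcal{A}))^+$ for all $n\ge 1$. (ii) Conversely, for every Hilbert space $H$, every unital $*$-subalgebra $\mathcal{D}$ of $B(H)$ is matrix ordered by the cones $M_n(\mathcal{D})^+ = M_n(\mathcal{D})\cap M_n(B(H))^+$, $n\ge 1$, and the unit of $\mathcal{D}$ is an Archimedean matrix order unit.
   Context: All $*$-algebras are associative complex algebras with involution. For a $*$-algebra $\mathcal{A}$, $M_n(\mathcal{A})$ carries the involution $(a_{ij})^*=(a_{ji}^* )$, and $M_n(\mathcal{A})_{sa}$ is the set of its self-adjoint elements; for $A=(a_{ij})\in M_{n\times m}(\mathcal{A})$, $A^*=(a_{ji}^* )\in M_{m\times n}(\mathcal{A})$. A cone in a real vector space is a subset closed under $\lambda x+\beta y$ for real $\lambda,\beta\ge 0$. A $*$-algebra $\mathcal{A}$ with unit $e$ is called matrix ordered if: (a) for each $n\ge 1$ a cone $C_n$ in $M_n(\mathcal{A})_{sa}$ is given, and $e\in C_1$; (b) $C_n\cap(-C_n)=\{0\}$ for all $n$; (c) for all $n,m$ and all $A\in M_{n\times m}(\mathcal{A})$, $A^*C_nA\subseteq C_m$. Put $e_n=e\otimes I_n\in M_n(\mathcal{A})$.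 The unit $e$ is a matrix order unit if for every $n$ and every $x\in M_n(\mathcal{A})_{sa}$ there is $r>0$ with $re_n+x\in C_n$. A matrix order unit $e$ is Archimedean if for all $n$ and $x\in M_n(\mathcal{A})_{sa}$: $re_n+x\in C_n$ for all $r>0$ implies $x\in C_n$. For a $*$-representation $\tau:\mathcal{A}\to B(H)$, $\tau^{(n)}:M_n(\mathcal{A})\to M_n(B(H))$ is $\tau^{(n)}((a_{ij}))=(\tau(a_{ij}))$. $M_n(B(H))$ is identified with $B(H^n)$, $M_n(B(H))^+$ is the set of positive operators on $H^n=H\oplus\cdots\oplus H$, and for a $*$-subalgebra $\mathcal{D}\subseteq B(H)$, $M_n(\mathcal{D})^+=M_n(\mathcal{D})\cap M_n(B(H))^+$. Subalgebras are not assumed to be closed. *)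

(* Defs.v *)
(* The complex numbers are R[i] with R : realType.  In the order of R[i],
   0 <= z means that z is real and nonnegative. *)
From HB Require Import structures.
From mathcomp Require Import all_boot all_order all_algebra complex.
From mathcomp Require Import boolp classical_sets functions reals topology.
From mathcomp Require Import normedtype sequences.
From mathcomp Require Import interval_inference ring lra.
Import numFieldNormedType.Exports.

Set Implicit Arguments.
Unset Strict Implicit.
Unset Printing Implicit Defensive.

Import Order.TTheory GRing.Theory Num.Theory.
Local Open Scope classical_set_scope.
Local Open Scope ring_scope.
Local Open Scope complex_scope.

(* GRing.Algebra is over nonzero rings, whereas B(H) and *-algebras may be zero.
   HB forbids a structure joining PzRing and Lmodule below GRing.LSemiAlgebra,
   so the scalar multiplication is part of the mixin and the Lmodule instance
   is derived from it. *)
HB.mixin Record isStarAlgebra (R : realType) A & GRing.PzRing A := {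
  cscale : R[i] -> A -> A;
  cscaleA : forall k l (a : A), cscale k (cscale l a) = cscale (k * l) a;
  cscale1 : left_id 1 cscale;
  cscaleDr : right_distributive cscale +%R;
  cscaleDl : forall a : A, {morph cscale^~ a : k l / k + l};
  cscaleAl : forall k (a b : A), cscale k (a * b) = cscale k a * b;
  cscaleAr : forall k (a b : A), cscale k (a * b) = a * cscale k b;
  star : A -> A;
  starD : {morph star : a b / a + b};
  starZ : forall k (a : A), star (cscale k a) = cscale k^* (star a);
  starM : forall a b : A, star (a * b) = star b * star a;
  starK : involutive star
}.

#[short(type="starAlgType")]
HB.structure Definition StarAlgebra (R : realType) :=
  {A of GRing.PzRing A & isStarAlgebra R A}.

#[non_forgetful_inheritance]
HB.instance Definition _ (R : realType) (A : starAlgType R) :=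
  GRing.Zmodule_isLmodule.Build R[i] A
    (@cscaleA R A) (@cscale1 R A) (@cscaleDr R A) (@cscaleDl R A).

(* Linear in the first argument, conjugate linear in the second. *)
HB.mixin Record CompleteNormedModule_isHilbert (R : realType) H
    & CompleteNormedModule R[i] H := {
  hdot : {dot H for Num.conj};
  hdot_norm : forall x : H, hdot x x = `|x| ^+ 2
}.

#[short(type="hilbertType")]
HB.structure Definition Hilbert (R : realType) :=
  {H of CompleteNormedModule R[i] H & CompleteNormedModule_isHilbert R H}.

Section HilbertTheory.
Variables (R : realType) (H : hilbertType R).
Implicit Types x y z : H.

Local Notation "<< x , y >>" := (@hdot R H x y).

Lemma hdotDl x y z : << x + y, z >> = << x, z >> + << y, z >>.
Proof. exact: linearDl. Qed.

Lemma hdotDr x y z : << z, x + y >> = << z, x >> + << z, y >>.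
Proof. exact: linearDr. Qed.

Lemma hdotBl x y z : << x - y, z >> = << x, z >> - << y, z >>.
Proof. exact: linearBl. Qed.

Lemma hdotBr x y z : << z, x - y >> = << z, x >> - << z, y >>.
Proof. exact: linearBr. Qed.

Lemma hdotZl (k : R[i]) x y : << k *: x, y >> = k * << x, y >>.
Proof. exact: linearZl_LR. Qed.

Lemma hdotZr (k : R[i]) x y : << x, k *: y >> = k^* * << x, y >>.
Proof. exact: linearZr_LR. Qed.

Lemma hdotC x y : << x, y >> = << y, x >>^*.
Proof. by have := hermitian_subproof (s := hdot) x y; rewrite expr0 mul1r. Qed.

Let nr x : R := complex.Re `|x|.
Let rdot x y : R := complex.Re << x, y >>.

Let nrE x : `|x| = (nr x)%:C.
Proof. by rewrite RRe_real// ger0_real. Qed.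

Let nr_ge0 x : 0 <= nr x.
Proof. by rewrite -ler0c -nrE. Qed.

Let rdotxx x : rdot x x = nr x ^+ 2.
Proof. by rewrite /rdot hdot_norm nrE -rmorphXn. Qed.

Let rdotC x y : rdot x y = rdot y x.
Proof. by rewrite /rdot hdotC; case: << y, x >>. Qed.

Let rdotDl x y z : rdot (x + y) z = rdot x z + rdot y z.
Proof. by rewrite /rdot hdotDl raddfD. Qed.

Let rdotDr x y z : rdot z (x + y) = rdot z x + rdot z y.
Proof. by rewrite /rdot hdotDr raddfD. Qed.

Let rdotZl (t : R) x y : rdot (t%:C *: x) y = t * rdot x y.
Proof. by rewrite /rdot hdotZl; case: << x, y >> => a b /=; rewrite mul0r subr0. Qed.

Let rdotZr (t : R) x y : rdot x (t%:C *: y) = t * rdot x y.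
Proof. by rewrite rdotC rdotZl rdotC. Qed.

Let rdotBr x y z : rdot z (x - y) = rdot z x - rdot z y.
Proof. by rewrite /rdot hdotBr raddfB. Qed.

Let discr (q b e : R) : 0 <= q ->
  (forall t, 0 <= e + 2 * t * b + t ^+ 2 * q) -> b ^+ 2 <= e * q.
Proof.
rewrite le_eqVlt => /predU1P[<-|q0] h.
  have [->|b0] := eqVneq b 0; first by rewrite expr0n/= mulr0.
  have := h (- (e + 1) / (2 * b)); rewrite mulr0 addr0.
  have -> : 2 * (- (e + 1) / (2 * b)) * b = - (e + 1) by field.
  by lra.
have := h (- b / q); have q1 : q != 0 by rewrite gt_eqF.
have -> : e + 2 * (- b / q) * b + (- b / q) ^+ 2 * q = (e * q - b ^+ 2) / q.
  by field.
by rewrite pmulr_lge0 ?invr_gt0// subr_ge0.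
Qed.

Let rdot_CS x y : rdot x y ^+ 2 <= nr x ^+ 2 * nr y ^+ 2.
Proof.
rewrite mulrC; apply: discr => [|t]; first exact: sqr_ge0.
have : 0 <= rdot (t%:C *: x + y) (t%:C *: x + y) by rewrite rdotxx sqr_ge0.
rewrite !(rdotDl, rdotDr, rdotZl, rdotZr) !rdotxx (rdotC y x).
by congr (_ <= _); ring.
Qed.

Lemma riesz (phi : H -> R[i]) (K : R) : linear_for *%R phi -> 0 <= K ->
  (forall x, complex.Re (phi x) ^+ 2 <= K * complex.Re `|x| ^+ 2) ->
  exists z, forall x, phi x = << x, z >>.
Proof.
move=> phil K0 phiK; pose f x := complex.Re (phi x).
have fD x y : f (x + y) = f x + f y.
  by rewrite /f -[x]scale1r phil mul1r scale1r raddfD.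
have phi0 : phi 0 = 0.
  have := phil 1 0 0; rewrite mul1r scale1r addr0 => /eqP.
  by rewrite -subr_eq0 opprD addNKr oppr_eq0 => /eqP.
have phiZ k x : phi (k *: x) = k * phi x by rewrite -[k *: x]addr0 phil phi0 addr0.
have fZ (t : R) x : f (t%:C *: x) = t * f x.
  by rewrite /f phiZ; case: (phi x) => a b /=; rewrite mul0r subr0.
pose J x := nr x ^+ 2 - 2 * f x.
have JD x u t : J (u + t%:C *: x) =
    J u + 2 * t * (rdot x u - f x) + t ^+ 2 * nr x ^+ 2.
  rewrite /J -!rdotxx !(rdotDl, rdotDr, rdotZl, rdotZr) fD fZ (rdotC u x); ring.
have Jlb x : - K <= J x.
  have := phiK x; rewrite -/(f x) -/(nr x) /J => fK.
  have : 2 * f x <= nr x ^+ 2 + K.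
    have s0 := sqr_ge0 (nr x); rewrite leNgt; apply/negP => h.
    have : (nr x ^+ 2 + K) ^+ 2 < (2 * f x) ^+ 2.
      by rewrite ltr_sqr ?nnegrE; lra.
    by have := sqr_ge0 (nr x ^+ 2 - K); nra.
  lra.
have infJ : has_inf (range J).
  by split; [exists (J 0), 0|exists (- K) => _ [x _ <-]].
set m := inf (range J).
have mJ x : m <= J x by apply: ge_inf; [case: infJ|exists x].
have /choice[u uP] : forall n, exists x, J x < m + n.+1%:R^-1.
  move=> n.
  have e0 : 0 < n.+1%:R^-1 :> R by rewrite invr_gt0.
  by have [_ [x _ <-]] := inf_adherent e0 infJ; exists x.
have key n x : (rdot x (u n) - f x) ^+ 2 <= n.+1%:R^-1 * nr x ^+ 2.
  apply: discr => [|t]; first exact: sqr_ge0.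
  have := uP n; have := mJ (u n + t%:C *: x); rewrite JD.
  move: (rdot _ _ - _) (nr x ^+ 2) (J _) (n.+1%:R^-1) => b q j c.
  by move: (2 * t * b) (t ^+ 2 * q) => {}b {}q; lra.
have uC n p : nr (u n - u p) ^+ 2 <= 2 * (n.+1%:R^-1 + p.+1%:R^-1).
  set x := u n - u p.
  have qE : nr x ^+ 2 = (rdot x (u n) - f x) - (rdot x (u p) - f x).
    by rewrite -rdotxx {2}/x rdotBr; ring.
  have := key n x; have := key p x; move: qE.
  set a := rdot _ _ - _; set b := rdot _ _ - _ => qE ha hb.
  have [q0|q0] := eqVneq (nr x ^+ 2) 0.
    by rewrite q0 mulr_ge0// addr_ge0// invr_ge0.
  have {}q0 : 0 < nr x ^+ 2 by rewrite lt_def q0 sqr_ge0.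
  rewrite -(ler_pM2r q0); have : (nr x ^+ 2) ^+ 2 <= 2 * (a ^+ 2 + b ^+ 2).
    by rewrite qE -subr_ge0 (_ : _ - _ = (a + b) ^+ 2) ?sqr_ge0//; ring.
  rewrite -expr2; move: ha hb.
  move: (nr x ^+ 2) (a ^+ 2) (b ^+ 2) (n.+1%:R^-1) (p.+1%:R^-1) => A B C D E.
  by rewrite expr2; lra.
have [z uz] : exists z, u @ \oo --> z.
  apply/cvg_ex; apply: cauchy_cvg; apply/cauchy_exP => e e0.
  have eE : e = (complex.Re e)%:C by rewrite RRe_real// ger0_real// ltW.
  have r0 : 0 < complex.Re e by rewrite -ltcR -eE.
  have [N _ NP] := near_infty_natSinv_lt (PosNum (divr_gt0 (exprn_gt0 2 r0) (ltr0Sn R 3))).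
  exists (u N); exists N => // n /= Nn.
  rewrite -ball_normE /ball_/= nrE eE ltcR.
  rewrite -(ltr_pXn2r (n := 2)) ?nnegrE ?nr_ge0 ?(ltW r0)//.
  have := NP N (leqnn N); have := NP n Nn => /= Pn PN.
  apply: le_lt_trans (uC N n) _.
  move: (N.+1%:R^-1) (n.+1%:R^-1) PN Pn => a b; lra.
have rdotf x : rdot x z = f x.
  have bnd n : (rdot x z - f x) ^+ 2 <=
      2 * (n.+1%:R^-1 * nr x ^+ 2) + 2 * (nr x ^+ 2 * nr (z - u n) ^+ 2).
    have := key n x; have := rdot_CS x (z - u n); rewrite rdotBr.
    move: (rdot x z) (rdot x (u n)) (f x) => a b c h1 h2.
    have -> : (a - c) ^+ 2 = 2 * (b - c) ^+ 2 + 2 * (a - b) ^+ 2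
        - (a - 2 * b + c) ^+ 2 by ring.
    rewrite lerBlDr ler_wpDr ?sqr_ge0// lerD// ler_wpM2l//.
  apply/eqP; rewrite -subr_eq0 -sqrf_eq0 eq_le sqr_ge0 andbT.
  apply/ler_addgt0Pl => e e0; rewrite addr0.
  set s := nr x ^+ 2 in bnd; have s0 : 0 <= s by exact: sqr_ge0.
  have d0 : 0 < e / (4 * (s + 1)) by rewrite divr_gt0// mulr_gt0//; lra.
  set d := e / _ in d0.
  have sd : 4 * s * d <= e.
    rewrite /d mulrA ler_pdivrMr; last by rewrite mulr_gt0//; lra.
    by nra.
  have sd0 : 0 < (Num.sqrt d)%:C :> R[i] by rewrite ltcR sqrtr_gt0.
  have /cvgrPdist_lt/(_ _ sd0) zu := uz.
  have [n [n1 n2]] := filter_ex (filterI (near_infty_natSinv_lt (PosNum d0)) zu).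
  rewrite /= nrE ltcR in n1 n2.
  have {}n2 : nr (z - u n) ^+ 2 < d.
    by rewrite -(sqr_sqrtr (ltW d0)) ltr_pXn2r// nnegrE ?nr_ge0 ?sqrtr_ge0.
  apply: le_trans (bnd n) _; apply: le_trans sd.
  have := ler_wpM2l s0 (ltW n1); have := ler_wpM2l s0 (ltW n2).
  by move: (n.+1%:R^-1) (nr _ ^+ 2) => a b; lra.
exists z => x; apply/eqP; rewrite eq_complex; apply/andP; split; apply/eqP.
  by rewrite -/(f x) -rdotf.
have := rdotf ('i *: x); rewrite /rdot /f hdotZl phiZ.
by case: (phi x) => a b; case: << x, z >> => c d /=; lra.
Qed.

Lemma Re_hdotxx x : complex.Re << x, x >> = complex.Re `|x| ^+ 2.
Proof. exact: rdotxx. Qed.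

Lemma Re_hdot_CS x y :
  complex.Re << x, y >> ^+ 2 <= complex.Re `|x| ^+ 2 * complex.Re `|y| ^+ 2.
Proof. exact: rdot_CS. Qed.

Lemma Re_normE x : (complex.Re `|x|)%:C = `|x|.
Proof. by rewrite -nrE. Qed.

Lemma Re_norm_ge0 x : 0 <= complex.Re `|x|.
Proof. exact: nr_ge0. Qed.

Lemma hdot_ext x y : (forall z, << z, x >> = << z, y >>) -> x = y.
Proof.
move=> /(_ (x - y)) xy; apply/eqP; rewrite -subr_eq0 -normr_eq0 -sqrf_eq0.
by rewrite -hdot_norm hdotBr xy subrr.
Qed.

End HilbertTheory.

Definition bounded_linear (R : realType) (H : hilbertType R) : {pred H -> H} :=
  fun f => `[< linear f /\ exists M : R, forall x, `|f x| <= M%:C * `|x| >].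

(* bop H is B(H). *)
Record bop (R : realType) (H : hilbertType R) := Bop {
  bop_fun :> H -> H;
  bop_funP : bop_fun \in @bounded_linear R H
}.

Section BoundedOperators.
Variables (R : realType) (H : hilbertType R).
Local Notation "<< x , y >>" := (@hdot R H x y).

HB.instance Definition _ := [isSub for @bop_fun R H].
HB.instance Definition _ := [Choice of bop H by <:].

Lemma bounded_linear_submod : GRing.submod_closed (@bounded_linear R H).
Proof.
split=> [|k f g /asboolP[lf [M fM]] /asboolP[lg [N gN]]]; apply/asboolP; split.
- by move=> a x y; rewrite scaler0 addr0.
- by exists 0 => x; rewrite normr0 mul0r.
- move=> a x y /=; rewrite !fctE lf lg !scalerDr !scalerA mulrC addrACA//.
- exists (complex.Re `|k| * M + N) => x; rewrite !fctE.
  have kE : (complex.Re `|k|)%:C = `|k| by rewrite RRe_real ?ger0_real.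
  apply: le_trans (ler_normD _ _) _; rewrite rmorphD mulrDl lerD//.
  by rewrite rmorphM /= kE normrZ -mulrA ler_wpM2l.
Qed.

HB.instance Definition _ :=
  GRing.isSubmodClosed.Build R[i] (H -> H) (@bounded_linear R H)
    bounded_linear_submod.
HB.instance Definition _ := [SubChoice_isSubLmodule of bop H by <:].

Implicit Types S T : bop H.

Lemma bop_linear T : linear T.
Proof. by case: T => T /= /asboolP[]. Qed.

Lemma bop_bounded T : exists M : R, forall x, `|T x| <= M%:C * `|x|.
Proof. by case: T => T /= /asboolP[]. Qed.

Lemma bopP S T : S =1 T -> S = T.
Proof. by move=> ST; apply/val_inj/funext. Qed.

Lemma bop_id_proof : id \in @bounded_linear R H.
Proof. by apply/asboolP; split=> //; exists 1 => x; rewrite mul1r. Qed.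

Lemma bop_comp_proof S T : S \o T \in @bounded_linear R H.
Proof.
have [[M SM] [N TN]] := (bop_bounded S, bop_bounded T).
apply/asboolP; split=> [a x y /=|]; first by rewrite !bop_linear.
exists (`|M| * `|N|) => x /=; rewrite rmorphM -mulrA.
have le_absC (a : R) : a%:C <= `|a|%:C by rewrite lecR ler_norm.
apply: le_trans (SM _) _; apply: le_trans (ler_wpM2r (normr_ge0 _) (le_absC M)) _.
rewrite ler_wpM2l ?ler0c//; apply: le_trans (TN _) _.
by rewrite ler_wpM2r.
Qed.

Definition bop1 : bop H := Bop bop_id_proof.
Definition bop_mul S T : bop H := Bop (bop_comp_proof S T).

Fact bop_mulA : associative bop_mul.
Proof. by move=> S T U; apply: bopP. Qed.

Fact bop_mul1l : left_id bop1 bop_mul.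
Proof. by move=> S; apply: bopP. Qed.

Fact bop_mul1r : right_id bop1 bop_mul.
Proof. by move=> S; apply: bopP. Qed.

Fact bop_mulDl : left_distributive bop_mul +%R.
Proof. by move=> S T U; apply: bopP. Qed.

Lemma bop_linearD T x y : T (x + y) = T x + T y.
Proof. by rewrite -[x in LHS]scale1r bop_linear scale1r. Qed.

Lemma bop0r T : T 0 = 0.
Proof. by apply: (addrI (T 0)); rewrite -bop_linearD !addr0. Qed.

Lemma bop_linearZ T k x : T (k *: x) = k *: T x.
Proof. by rewrite -[k *: x]addr0 bop_linear bop0r addr0. Qed.

Fact bop_mulDr : right_distributive bop_mul +%R.
Proof. by move=> S T U; apply: bopP => x; exact: bop_linearD. Qed.

HB.instance Definition _ := GRing.Zmodule_isPzRing.Build (bop H)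
  bop_mulA bop_mul1l bop_mul1r bop_mulDl bop_mulDr.

Lemma bop_Re_bounded T : exists2 M : R, 0 <= M &
  forall x, complex.Re `|T x| ^+ 2 <= M * complex.Re `|x| ^+ 2.
Proof.
have [M TM] := bop_bounded T; exists (M ^+ 2) => [|x]; first exact: sqr_ge0.
have := TM x; rewrite -(Re_normE x) -(Re_normE (T x)) -rmorphM lecR => h.
rewrite -exprMn lerXn2r ?nnegrE ?Re_norm_ge0//.
exact: le_trans (Re_norm_ge0 _) h.
Qed.

Lemma bop_adj_subproof T : exists S, forall x y, << T x, y >> = << x, S y >>.
Proof.
have [M M0 TM] := bop_Re_bounded T.
have /choice[f fP] : forall y, exists z, forall x, << T x, y >> = << x, z >>.
  move=> y; apply: (@riesz _ _ _ (M * complex.Re `|y| ^+ 2)).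
  - by move=> a u v; rewrite bop_linear hdotDl hdotZl.
  - by rewrite mulr_ge0 ?sqr_ge0.
  - move=> x; apply: le_trans (Re_hdot_CS _ _) _.
    by rewrite [leRHS]mulrAC ler_wpM2r ?sqr_ge0.
suff fB : f \in @bounded_linear R H by exists (Bop fB) => x y; rewrite fP.
apply/asboolP; split=> [a x y|].
  by apply: hdot_ext => z; rewrite -fP !hdotDr !hdotZr !fP.
exists (Num.sqrt M) => y; rewrite -(Re_normE y) -(Re_normE (f y)) -rmorphM lecR.
rewrite -ler_sqr ?nnegrE ?mulr_ge0 ?sqrtr_ge0 ?Re_norm_ge0//.
rewrite exprMn sqr_sqrtr//; set q := complex.Re `|f y| ^+ 2.
have qq : q ^+ 2 <= M * q * complex.Re `|y| ^+ 2.
  have {1}-> : q = complex.Re << T (f y), y >> by rewrite fP Re_hdotxx.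
  apply: le_trans (Re_hdot_CS _ _) _.
  by rewrite ler_wpM2r ?sqr_ge0// TM.
have [->|q0] := eqVneq q 0; first by rewrite mulr_ge0 ?sqr_ge0.
have {}q0 : 0 < q by rewrite lt_def q0 sqr_ge0.
by rewrite -(ler_pM2r q0) -expr2 mulrAC.
Qed.

Definition bop_adj T : bop H := projT1 (cid (bop_adj_subproof T)).

Lemma bop_adjP T x y : << T x, y >> = << x, bop_adj T y >>.
Proof. by rewrite /bop_adj; case: cid. Qed.

Fact bop_adjK : involutive bop_adj.
Proof.
move=> T; apply: bopP => x; apply: hdot_ext => z.
by rewrite -bop_adjP hdotC -bop_adjP -hdotC.
Qed.

Fact bop_adjD : {morph bop_adj : S T / S + T}.
Proof.
move=> S T; apply: bopP => x; apply: hdot_ext => z.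
by rewrite -bop_adjP hdotDl hdotDr !bop_adjP.
Qed.

Fact bop_adjZ (k : R[i]) T : bop_adj (k *: T) = k^* *: bop_adj T.
Proof.
apply: bopP => x; apply: hdot_ext => z.
rewrite -bop_adjP -[RHS]/(<< z, k^* *: bop_adj T x >>).
by rewrite hdotZl hdotZr conjCK bop_adjP.
Qed.

Fact bop_adjM S T : bop_adj (S * T) = bop_adj T * bop_adj S.
Proof.
apply: bopP => x; apply: hdot_ext => z.
by rewrite -bop_adjP /= !bop_adjP.
Qed.

Fact bop_scaleAl (k : R[i]) S T : k *: (S * T) = k *: S * T.
Proof. by apply: bopP. Qed.

Fact bop_scaleAr (k : R[i]) S T : k *: (S * T) = S * (k *: T).
Proof. by apply: bopP => x; rewrite /= /GRing.scale/= bop_linearZ. Qed.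

HB.instance Definition _ := isStarAlgebra.Build R (bop H)
  (@scalerA _ _) (@scale1r _ _) (@scalerDr _ _) (fun v => @scalerDl _ _ v)
  bop_scaleAl bop_scaleAr bop_adjD bop_adjZ bop_adjM bop_adjK.
End BoundedOperators.

(* The unit of a unital subalgebra need not be the unit of A. *)
Record unitalStarSubalg (R : realType) (A : starAlgType R) := UnitalStarSubalg {
  ssa_set :> set A;
  ssa_linear : forall (k : R[i]) a b,
    ssa_set a -> ssa_set b -> ssa_set (k *: a + b);
  ssa_mul : forall a b, ssa_set a -> ssa_set b -> ssa_set (a * b);
  ssa_star : forall a, ssa_set a -> ssa_set (star a);
  ssa_one : A;
  ssa_one_in : ssa_set ssa_one;
  ssa_mul1l : forall a, ssa_set a -> ssa_one * a = a;
  ssa_mul1r : forall a, ssa_set a -> a * ssa_one = a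
}.

Definition ssa_pred (R : realType) (A : starAlgType R) (D : unitalStarSubalg A)
  : {pred A} := fun a => a \in ssa_set D.

(* The subalgebra D as a type, with its own unit. *)
Record subalg (R : realType) (A : starAlgType R) (D : unitalStarSubalg A) :=
  Subalg { ssa_val :> A; ssa_valP : ssa_val \in ssa_pred D }.

Section Subalgebra.
Variables (R : realType) (A : starAlgType R) (D : unitalStarSubalg A).

HB.instance Definition _ := [isSub for @ssa_val R A D].
HB.instance Definition _ := [Choice of subalg D by <:].

Lemma ssa_predP a : reflect (ssa_set D a) (a \in ssa_pred D).
Proof. exact: asboolP. Qed.

Lemma ssa_submod_closed : GRing.submod_closed (ssa_pred D).
Proof.
split=> [|k a b /ssa_predP Da /ssa_predP Db]; apply/ssa_predP.
  by have := ssa_linear (-1) (ssa_one_in D) (ssa_one_in D); rewrite scaleN1r addNr.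
exact: ssa_linear.
Qed.

HB.instance Definition _ :=
  GRing.isSubmodClosed.Build R[i] A (ssa_pred D) ssa_submod_closed.
HB.instance Definition _ := [SubChoice_isSubLmodule of subalg D by <:].

Implicit Types a b : subalg D.

Lemma ssa_valD a : ssa_set D (val a).
Proof. exact/ssa_predP/valP. Qed.

Definition subalg1 : subalg D := Subalg (introT (ssa_predP _) (ssa_one_in D)).
Definition subalg_mul a b : subalg D :=
  Subalg (introT (ssa_predP _) (ssa_mul (ssa_valD a) (ssa_valD b))).
Definition subalg_star a : subalg D :=
  Subalg (introT (ssa_predP _) (ssa_star (ssa_valD a))).

Fact subalg_mulA : associative subalg_mul.
Proof. by move=> a b c; apply: val_inj; exact: mulrA. Qed.

Fact subalg_mul1l : left_id subalg1 subalg_mul.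
Proof. by move=> a; apply/val_inj/ssa_mul1l/ssa_valD. Qed.

Fact subalg_mul1r : right_id subalg1 subalg_mul.
Proof. by move=> a; apply/val_inj/ssa_mul1r/ssa_valD. Qed.

Fact subalg_mulDl : left_distributive subalg_mul +%R.
Proof. by move=> a b c; apply: val_inj; exact: mulrDl. Qed.

Fact subalg_mulDr : right_distributive subalg_mul +%R.
Proof. by move=> a b c; apply: val_inj; exact: mulrDr. Qed.

HB.instance Definition _ := GRing.Zmodule_isPzRing.Build (subalg D)
  subalg_mulA subalg_mul1l subalg_mul1r subalg_mulDl subalg_mulDr.

Fact subalg_scaleAl (k : R[i]) a b : k *: (a * b) = k *: a * b.
Proof. by apply: val_inj; exact: cscaleAl. Qed.

Fact subalg_scaleAr (k : R[i]) a b : k *: (a * b) = a * (k *: b).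
Proof. by apply: val_inj; exact: cscaleAr. Qed.

Fact subalg_starD : {morph subalg_star : a b / a + b}.
Proof. by move=> a b; apply: val_inj; exact: starD. Qed.

Fact subalg_starZ (k : R[i]) a : subalg_star (k *: a) = k^* *: subalg_star a.
Proof. by apply: val_inj; exact: starZ. Qed.

Fact subalg_starM a b : subalg_star (a * b) = subalg_star b * subalg_star a.
Proof. by apply: val_inj; exact: starM. Qed.

Fact subalg_starK : involutive subalg_star.
Proof. by move=> a; apply: val_inj; exact: starK. Qed.

HB.instance Definition _ := isStarAlgebra.Build R (subalg D)
  (@scalerA _ _) (@scale1r _ _) (@scalerDr _ _) (fun v => @scalerDl _ _ v)
  subalg_scaleAl subalg_scaleAr
  subalg_starD subalg_starZ subalg_starM subalg_starK.
End Subalgebra.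

Section MatrixOrder.
Variables (R : realType) (A : starAlgType R).

Definition adjmx m n (X : 'M[A]_(m, n)) : 'M[A]_(n, m) := map_mx star X^T.

Definition selfadjmx n : set 'M[A]_n := [set X | adjmx X = X].

(* 'M[A]_n is a module over A only, hence this scalar multiplication. *)
Definition rscalemx (r : R) n (X : 'M[A]_n) : 'M[A]_n :=
  map_mx (fun a => r%:C *: a) X.

Definition is_cone n (S : set 'M[A]_n) := forall (r s : R) X Y,
  0 <= r -> 0 <= s -> S X -> S Y -> S (rscalemx r X + rscalemx s Y).

(* A family of cones is indexed by all n : nat but only n > 0 matters. *)
Definition matrix_ordered (C : forall n, set 'M[A]_n) :=
  [/\ forall n, (0 < n)%N -> C n `<=` @selfadjmx n /\ is_cone (C n),
      C 1%N 1%:M,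
      forall n, (0 < n)%N -> C n `&` [set - X | X in C n] = [set 0] &
      forall n m (B : 'M[A]_(n, m)) (X : 'M[A]_n),
        (0 < n)%N -> (0 < m)%N -> C n X -> C m (adjmx B *m X *m B)].

(* r e_n is rscalemx r 1%:M. *)
Definition matrix_order_unit (C : forall n, set 'M[A]_n) :=
  forall n (X : 'M[A]_n), (0 < n)%N -> selfadjmx X ->
    exists2 r : R, 0 < r & C n (rscalemx r 1%:M + X).

Definition archimedean_matrix_order_unit (C : forall n, set 'M[A]_n) :=
  matrix_order_unit C /\
  forall n (X : 'M[A]_n), (0 < n)%N -> selfadjmx X ->
    (forall r : R, 0 < r -> C n (rscalemx r 1%:M + X)) -> C n X.
End MatrixOrder.
Arguments selfadjmx {R A} n _.

Section Operators.
Variables (R : realType) (H : hilbertType R).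

Definition star_representation (A : starAlgType R) (tau : A -> bop H) :=
  [/\ linear tau, {morph tau : a b / a * b} & {morph tau : a / star a}].

(* M_n(B(H)) = B(H^n): a matrix acts on column vectors v : 'I_n -> H. *)
Definition mxop n (X : 'M[bop H]_n) (v : 'I_n -> H) : 'I_n -> H :=
  fun i => \sum_j X i j (v j).

Definition dsum_hdot n (v w : 'I_n -> H) : R[i] := \sum_i hdot (v i) (w i).

(* <Xv, v> >= 0 on H^n; H being complex, this forces X to be self-adjoint. *)
Definition mxop_positive n (X : 'M[bop H]_n) :=
  forall v, 0 <= dsum_hdot (mxop X v) v.

(* mxpos D n is M_n(D)^+, for D a subset of B(H). *)
Definition mxpos (D : set (bop H)) n : set 'M[bop H]_n :=
  [set X : 'M[bop H]_n | (forall i j, D (X i j)) /\ mxop_positive X].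
End Operators.
Arguments mxpos {R H} D n _.

(* Main.v *)
(** For every n and every self-adjoint X in M_n(A) outside C_n, the Archimedean
    property and an extension of C_n to a maximal cone give a linear functional
    G on M_n(A) that is nonnegative on C_n but not at X.  Such a G makes the
    rows A^n a semi-inner product space through <b, c> = G (c^* b), on which A
    acts by left multiplication.  If the rows x_1, .., x_m form the matrix B and
    Z lies in M_m(A), then sum_(p,q) <Z_pq x_q, x_p> = G (B^* Z B), which is
    nonnegative for Z in C_m because B^* C_m B is contained in C_n; with B = 1
    and Z = X it equals G X.  Each a acts boundedly because r e - a^* a lies in
    C_1 for some r.  The algebraic direct sum over all functionals is completed
    to a Hilbert space H, realised as the conjugate linear functionals that are
    pointwise limits of <u_n, .> for a Cauchy sequence u; there a acts by
    f |-> f o a^*. *)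
Require Import Defs.
From HB Require Import structures.
From mathcomp Require Import all_boot all_order all_algebra complex.
From mathcomp Require Import boolp classical_sets functions cardinality fsbigop.
From mathcomp Require Import reals topology normedtype sequences.
From mathcomp Require Import interval_inference ring lra.
Import numFieldNormedType.Exports.

Set Implicit Arguments.
Unset Strict Implicit.
Unset Printing Implicit Defensive.

Import Order.TTheory GRing.Theory Num.Theory.
Local Open Scope classical_set_scope.
Local Open Scope ring_scope.
Local Open Scope complex_scope.

(** * Separation of a point from a convex cone *)

(** The cone [C_n] lives only among self-adjoint matrices, whereas the extension is made on a whole
    vector space. So it is replaced by the cone of all Y with Y + Y^* in [C_n]. This contains every
    skew-adjoint matrix with both signs, which makes the separating functional F invariant under the
    involution, and G(Y) = F(Y) - i F(iY) is then hermitian. The separation must be strict, and the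
    Archimedean property supplies the gap: if X is outside [C_n], so is some r e_n + X with r > 0,
    and F(e_n) = 1 with F(r e_n + X) <= 0 forces F(X) <= -r. States of all sizes n enter one direct
    sum, so that a single representation detects every [C_n]. Order is detected on self-adjoint
    matrices only; hence injectivity is drawn from the properness of [C_1], and it comes before the
    equality of cones because it shows that a preimage of a positive matrix is self-adjoint. In the
    converse the obstacle is that the unit e of D may be a projection other than the identity of H:
    quadratic forms are evaluated at e_n w instead of w, where r e_n behaves like r times the
    identity. *)

Section ConeSeparation.
Variables (R : realType) (E : lmodType R[i]).
Implicit Types (K M : set E) (e x y z : E).

Definition convex_cone K := forall (r s : R) x y,
  0 <= r -> 0 <= s -> K x -> K y -> K (r%:C *: x + s%:C *: y).

Lemma convex_coneD K x y : convex_cone K -> K x -> K y -> K (x + y).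
Proof.
by move=> Kc Kx Ky; have := Kc 1 1 x y ler01 ler01 Kx Ky; rewrite !scale1r.
Qed.

Lemma convex_coneZ K (r : R) x : convex_cone K -> 0 <= r -> K x ->
  K (r%:C *: x).
Proof.
move=> Kc r0 Kx; have := Kc r 0 x x r0 (lexx _) Kx Kx.
by rewrite scale0r addr0.
Qed.

Lemma convex_cone_scale_ge0 K e (t : R) : convex_cone K -> ~ K (- e) ->
  K (t%:C *: e) -> 0 <= t.
Proof.
move=> Kc Ke Kte; rewrite leNgt; apply/negP => t0; apply: Ke.
have t1 : 0 <= - t^-1 by rewrite oppr_ge0 invr_le0 ltW.
have := convex_coneZ Kc t1 Kte.
by rewrite scalerA -rmorphM mulNr mulVf ?lt_eqF// rmorphN scaleN1r.
Qed.

(** A maximal cone avoiding [- e] is total: if it contained neither y nor -y, adjoining either one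
    would produce [- e], and eliminating y between the two resulting identities leaves a negative
    multiple of e in the cone. *)
Lemma total_cone_extension K e : convex_cone K -> K 0 -> ~ K (- e) ->
  exists M, [/\ convex_cone M, K `<=` M, ~ M (- e) &
    forall y, M y \/ M (- y)].
Proof.
move=> Kc K0 Ke.
pose P : set (set E) :=
  [set B | B = set0 \/ [/\ convex_cone B, K `<=` B & ~ B (- e)]].
have [F FP Ft|M [PM Mmax]] := @Zorn_bigcup E P.
  have [Fne|F0] := pselect (exists2 B, F B & B !=set0); last first.
    left; apply/seteqP; split=> // x [B FB Bx]; apply: F0.
    by exists B => //; exists x.
  have chainP B : F B -> B !=set0 -> [/\ convex_cone B, K `<=` B & ~ B (- e)].
    by move=> /FP[->|//] [].
  right; split.
  - move=> r s x y r0 s0 [B FB Bx] [B' FB' By].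
    have [BB|BB] := Ft _ _ FB FB'.
      exists B' => //; have [] := chainP _ FB'; first by exists y.
      by move=> /(_ r s x y r0 s0 (BB _ Bx) By).
    exists B => //; have [] := chainP _ FB; first by exists x.
    by move=> /(_ r s x y r0 s0 Bx (BB _ By)).
  - case: Fne => B FB B0; have [_ KB _] := chainP _ FB B0.
    by move=> x Kx; exists B => //; exact: KB.
  - by move=> [B FB Be]; have [] := chainP _ FB; [exists (- e)|].
have {PM} [Mc KM Me] : [/\ convex_cone M, K `<=` M & ~ M (- e)].
  case: PM => // M0; exfalso; apply: (Mmax K); last by right; split.
  by rewrite M0; split=> [//|/(_ _ K0)].
exists M; split=> // y.
have M0 := KM _ K0.
pose M' w := [set m + s%:C *: w | m in M & s in [set s : R | 0 <= s]].
have adjoin w : ~ M w -> exists m (s : R),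
    [/\ M m, 0 <= s & - e = m + s%:C *: w].
  move=> Mw; apply: contrapT => Me'; apply: (Mmax (M' w)).
    split=> [|MM]; last first.
      by apply/Mw/MM; exists 0 => //; exists 1; rewrite /= ?scale1r ?add0r.
    by move=> x Mx; exists x => //; exists 0; rewrite /= ?scale0r ?addr0.
  right; split.
  - move=> r s _ _ r0 s0 [m1 Mm1 [t1 t10 <-]] [m2 Mm2 [t2 t20 <-]].
    exists (r%:C *: m1 + s%:C *: m2); first exact: Mc.
    exists (r * t1 + s * t2); first by rewrite /= addr_ge0// mulr_ge0.
    by rewrite !scalerDr rmorphD !rmorphM scalerDl !scalerA addrACA.
  - by move=> x /KM Mx; exists x => //; exists 0; rewrite /= ?scale0r ?addr0.
  - by move=> [m Mm [s s0 ms]]; apply: Me'; exists m, s.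
apply: contrapT => /not_orP[/adjoin[m [s [Mm s0 me]]]
  /adjoin[m' [s' [Mm' s'0 me']]]].
have {}s0 : 0 < s.
  rewrite lt_def s0 andbT; apply/eqP => s00; apply: Me.
  by rewrite me s00 scale0r addr0.
have : M ((- (s + s'))%:C *: e).
  suff -> : (- (s + s'))%:C *: e = s'%:C *: m + s%:C *: m'.
    by apply: Mc => //; lra.
  have -> : m = - e - s%:C *: y by rewrite me addrK.
  have -> : m' = - e + s'%:C *: y by rewrite me' scalerN subrK.
  rewrite !scalerDr !scalerN !scalerA (mulrC s'%:C) addrACA addNr addr0.
  by rewrite rmorphN rmorphD scaleNr scalerDl opprD addrC.
by move=> /(convex_cone_scale_ge0 Mc Me); lra.
Qed.

(** As M is total, the infimum of all t with t e - y in M is a Dedekind cut: above it t e - y lies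
    in M, below it y - t e does. Additivity and homogeneity follow by adding and scaling such
    memberships. *)
Lemma total_cone_functional M e : convex_cone M -> M e -> ~ M (- e) ->
  (forall y, M y \/ M (- y)) -> (forall y, exists r : R, M (r%:C *: e + y)) ->
  exists F : E -> R, [/\ {morph F : x y / x + y},
    forall (t : R) x, F (t%:C *: x) = t * F x,
    forall x, M x -> 0 <= F x & F e = 1].
Proof.
move=> Mc Me MNe Mt Mu.
pose S y := [set t : R | M (t%:C *: e - y)].
pose F y := inf (S y).
have MZe (t : R) : 0 <= t -> M (t%:C *: e) by move=> t0; exact: convex_coneZ.
have Sle y (t t' : R) : M (t%:C *: e - y) -> M (y - t'%:C *: e) -> t' <= t.
  move=> /(convex_coneD Mc)/[apply]; rewrite addrA subrK -scalerBl -rmorphB.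
  by move=> /(convex_cone_scale_ge0 Mc MNe); rewrite subr_ge0.
have Sinf y : has_inf (S y).
  split; first by have [r] := Mu (- y); exists r.
  have [r Mr] := Mu y; exists (- r) => t /= /Sle; apply.
  by rewrite rmorphN scaleNr opprK addrC.
have Fle y (t : R) : M (t%:C *: e - y) -> F y <= t.
  by move=> tS; apply: ge_inf => //; case: (Sinf y).
have Fge y (t : R) : M (y - t%:C *: e) -> t <= F y.
  by move=> tS; apply: lb_le_inf; [case: (Sinf y)|move=> t' /Sle; exact].
have Flt y (t : R) : t < F y -> M (y - t%:C *: e).
  move=> tF; rewrite -opprB; have [/Fle|//] := Mt (t%:C *: e - y).
  by rewrite leNgt tF.
have Fgt y (t : R) : F y < t -> M (t%:C *: e - y).
  move=> Ft; have [/Fge|] := Mt (y - t%:C *: e); last by rewrite opprB.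
  by rewrite leNgt Ft.
(* The margin d is there because nothing is known at the cut point itself. *)
have Feq y (a : R) : (forall d : R, 0 < d -> M ((a + d)%:C *: e - y)) ->
    (forall d : R, 0 < d -> M (y - (a - d)%:C *: e)) -> F y = a.
  move=> h1 h2; apply/le_anti/andP; split; apply/ler_addgt0Pr => d d0.
    exact/Fle/h1.
  by rewrite -lerBlDr; exact/Fge/h2.
have FD : {morph F : x y / x + y}.
  move=> y z; apply: Feq => d d0; have d2 : 0 < d / 2 by rewrite divr_gt0.
    have -> : (F y + F z + d)%:C *: e - (y + z) =
      ((F y + d / 2)%:C *: e - y) + ((F z + d / 2)%:C *: e - z).
      have -> : F y + F z + d = (F y + d / 2) + (F z + d / 2) by field.
      by rewrite rmorphD scalerDl opprD addrACA.
    by apply: convex_coneD => //; apply: Fgt; lra.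
  have -> : y + z - (F y + F z - d)%:C *: e =
    (y - (F y - d / 2)%:C *: e) + (z - (F z - d / 2)%:C *: e).
    have -> : F y + F z - d = (F y - d / 2) + (F z - d / 2) by field.
    by rewrite rmorphD scalerDl opprD addrACA.
  by apply: convex_coneD => //; apply: Flt; lra.
have F0 : F 0 = 0 by have := FD 0 0; rewrite addr0; lra.
have FN y : F (- y) = - F y.
  by have := FD y (- y); rewrite subrr F0; lra.
have FZ0 (t : R) x : 0 < t -> F (t%:C *: x) = t * F x.
  move=> t0; have t1 : t != 0 by rewrite gt_eqF.
  apply: Feq => d d0; have dt : 0 < d / t by rewrite divr_gt0.
    have -> : (t * F x + d)%:C *: e - t%:C *: x =
      t%:C *: ((F x + d / t)%:C *: e - x).
      have -> : t * F x + d = t * (F x + d / t) by field.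
      by rewrite rmorphM -scalerA scalerBr.
    by apply: convex_coneZ => //; [lra|apply: Fgt; lra].
  have -> : t%:C *: x - (t * F x - d)%:C *: e =
    t%:C *: (x - (F x - d / t)%:C *: e).
    have -> : t * F x - d = t * (F x - d / t) by field.
    by rewrite rmorphM -scalerA scalerBr.
  by apply: convex_coneZ => //; [lra|apply: Flt; lra].
exists F; split=> //.
- move=> t x; have [t0|t0|->] := ltgtP t 0; last first.
  + by rewrite scale0r F0 mul0r.
  + exact: FZ0.
  + by rewrite -[t in LHS]opprK rmorphN scaleNr FN FZ0 ?oppr_gt0//; lra.
- by move=> x Mx; apply: Fge; rewrite scale0r subr0.
- apply: Feq => d d0.
    have -> : (1 + d)%:C *: e - e = d%:C *: e.
      by rewrite rmorphD scalerDl scale1r addrAC subrr add0r.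
    by apply: MZe; lra.
  have -> : e - (1 - d)%:C *: e = d%:C *: e.
    by rewrite rmorphB scalerBl scale1r opprB addrCA subrr addr0.
  by apply: MZe; lra.
Qed.

(** The cone to be extended is K with -(r e + x) adjoined. It still misses [- e]: otherwise a
    positive multiple of r e + x would equal k + e for some k in K, or [- e] would lie in K
    already. *)
Lemma cone_separation K e x (r : R) : convex_cone K -> K e ->
  (forall y, exists t : R, K (t%:C *: e + y)) ->
  0 < r -> ~ K (r%:C *: e + x) ->
  exists F : E -> R, [/\ {morph F : x y / x + y},
    forall (t : R) x, F (t%:C *: x) = t * F x,
    forall x, K x -> 0 <= F x & F x < 0].
Proof.
move=> Kc Ke Ku r0 Kx; set y := r%:C *: e + x in Kx.
have K0 : K 0 by have := convex_coneZ Kc (lexx 0) Ke; rewrite scale0r.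
pose K' := [set k - s%:C *: y | k in K & s in [set s : R | 0 <= s]].
have K'c : convex_cone K'.
  move=> t s _ _ t0 s0 [m1 Km1 [t1 t10 <-]] [m2 Km2 [t2 t20 <-]].
  exists (t%:C *: m1 + s%:C *: m2); first exact: Kc.
  exists (t * t1 + s * t2); first by rewrite /= addr_ge0// mulr_ge0.
  by rewrite !scalerBr rmorphD !rmorphM scalerDl !scalerA addrACA opprD.
have KK' : K `<=` K'.
  by move=> z Kz; exists z => //; exists 0; rewrite /= ?scale0r ?subr0.
have K'y : K' (- y).
  by exists 0 => //; exists 1; rewrite /= ?scale1r ?sub0r.
have K'e : ~ K' (- e).
  move=> [k Kk [s s0 ks]].
  have sy : s%:C *: y = k + e by rewrite -[e]opprK -ks opprB addrC subrK.
  have {}s0 : 0 <= s by [].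
  (* If s = 0 then [- e] is in K, so K contains all real multiples of e and, by the order unit
     property, y itself. *)
  have [s00|sn0] := eqVneq s 0.
    have Ke' : K (- e).
      suff -> : - e = k by [].
      by apply/eqP; rewrite eq_sym -addr_eq0 -sy s00 scale0r.
    apply: Kx; have [t Kt] := Ku y.
    have [t0|t0] := leP 0 t.
      suff -> : y = t%:C *: (- e) + (t%:C *: e + y).
        by apply: convex_coneD => //; exact: convex_coneZ.
      by rewrite scalerN addKr.
    suff -> : y = (- t)%:C *: e + (t%:C *: e + y).
      by apply: convex_coneD => //; apply: convex_coneZ => //; lra.
    by rewrite rmorphN scaleNr addKr.
  apply: Kx; have -> : y = (s^-1)%:C *: (k + e).
    by rewrite -sy scalerA -rmorphM mulVf// scale1r.
  by apply: convex_coneZ; rewrite ?invr_ge0//; exact: convex_coneD.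
have [M [Mc KM Me Mt]] := total_cone_extension K'c (KK' _ K0) K'e.
have Mu z : exists t : R, M (t%:C *: e + z).
  by have [t Kt] := Ku z; exists t; exact/KM/KK'.
have [F [FD FZ F0 F1]] := total_cone_functional Mc (KM _ (KK' _ Ke)) Me Mt Mu.
exists F; split=> // [z Kz|]; first exact/F0/KM/KK'.
have := F0 _ (KM _ K'y).
by rewrite -scaleN1r -(rmorphN1 (real_complex R)) FZ /y FD FZ F1; lra.
Qed.

End ConeSeparation.

(** * Completion of a semi-inner product space *)

Section ComplexLimits.
Variable R : realType.
Implicit Types (z w : nat -> R[i]) (a b k : R[i]).

(** Convergence is taken by components, so that the limit theory of the real line applies
    directly. *)
Definition ccvg z a :=
  (fun n => complex.Re (z n)) @ \oo --> complex.Re a /\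
  (fun n => complex.Im (z n)) @ \oo --> complex.Im a.

Lemma ccvg_unique z a b : ccvg z a -> ccvg z b -> a = b.
Proof.
move=> [za za'] [zb zb']; apply/eqP; rewrite eq_complex.
apply/andP; split; apply/eqP; first exact: cvg_unique za zb.
exact: cvg_unique za' zb'.
Qed.

Lemma ccvg_cst a : ccvg (fun=> a) a.
Proof. by split; exact: cvg_cst. Qed.

Lemma ccvgD z w a b : ccvg z a -> ccvg w b -> ccvg (fun n => z n + w n) (a + b).
Proof.
move=> [za za'] [wb wb']; split; under eq_fun do rewrite raddfD;
  by rewrite raddfD; exact: cvgD.
Qed.

Lemma ccvgZ k z a : ccvg z a -> ccvg (fun n => k * z n) (k * a).
Proof.
case: k a => kr ki [ar ai] [za za']; split=> /=.
  have -> : (fun n => complex.Re ((kr +i* ki) * z n)) =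
      (fun n => kr * complex.Re (z n) - ki * complex.Im (z n)).
    by apply/funext => n; case: (z n).
  by apply: cvgB; apply: cvgM => //; exact: cvg_cst.
have -> : (fun n => complex.Im ((kr +i* ki) * z n)) =
    (fun n => kr * complex.Im (z n) + ki * complex.Re (z n)).
  by apply/funext => n; case: (z n).
by apply: cvgD; apply: cvgM => //; exact: cvg_cst.
Qed.

Lemma ccvg_conj z a : ccvg z a -> ccvg (fun n => (z n)^*) a^*.
Proof.
case: a => ar ai [za za']; split=> /=.
  by have -> : (fun n => complex.Re (z n)^*) = (fun n => complex.Re (z n))
    by apply/funext => n; case: (z n).
have -> : (fun n => complex.Im (z n)^*) = (fun n => - complex.Im (z n)).
  by apply/funext => n; case: (z n).
exact: cvgN.
Qed.

Lemma ccvg_sum (I : Type) (r : seq I) (z : I -> nat -> R[i]) (a : I -> R[i]) :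
  (forall i, ccvg (z i) (a i)) ->
  ccvg (fun n => \sum_(i <- r) z i n) (\sum_(i <- r) a i).
Proof.
move=> za; elim: r => [|i r IH].
  rewrite big_nil; under eq_fun do rewrite big_nil; exact: ccvg_cst.
rewrite big_cons; under eq_fun do rewrite big_cons; exact: ccvgD.
Qed.

Lemma ccvg_Re_ge0 z a : (forall n, 0 <= complex.Re (z n)) -> ccvg z a ->
  0 <= complex.Re a.
Proof.
move=> z0 [za _]; rewrite -(cvg_lim _ za)//; apply: limr_ge; last exact: nearW.
by apply/cvg_ex; exists (complex.Re a).
Qed.

Lemma ccvg_ge0 z a : (forall n, 0 <= z n) -> ccvg z a -> 0 <= a.
Proof.
move=> z0 za; have [_ za'] := za; rewrite lecE.
apply/andP; split; last first.
  by apply: ccvg_Re_ge0 za => n; have := z0 n; rewrite lecE => /andP[].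
suff Imz : (fun n => complex.Im (z n)) @ \oo --> (0 : R).
  exact/eqP/(cvg_unique _ za' Imz).
have -> : (fun n => complex.Im (z n)) = (fun=> 0); last exact: cvg_cst.
by apply/funext => n; have := z0 n; rewrite lecE => /andP[/eqP].
Qed.

Lemma cauchy_seq_cvg (x : nat -> R) :
  (forall e, 0 < e -> exists N, forall n m, (N <= n)%N -> (N <= m)%N ->
    `|x n - x m| <= e) -> exists l : R, x @ \oo --> l.
Proof.
move=> xC; apply/cvg_ex; apply: cauchy_cvg; apply/cauchy_exP => e e0.
have [N NP] := xC _ (divr_gt0 e0 (ltr0Sn R 1)).
exists (x N); exists N => // n /= Nn; rewrite /ball/=.
by apply: le_lt_trans (NP _ _ (leqnn N) Nn) _; lra.
Qed.

End ComplexLimits.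

(** * Semi-inner product spaces and their real seminorm *)

Record semidot (R : realType) (V : lmodType R[i]) := Semidot {
  sdot :> V -> V -> R[i];
  sdot_linear : forall k x y z, sdot (k *: x + y) z = k * sdot x z + sdot y z;
  sdotC : forall x y, sdot x y = (sdot y x)^*;
  sdot_Re_ge0 : forall x, 0 <= complex.Re (sdot x x)
}.

Section SemidotTheory.
Variables (R : realType) (V : lmodType R[i]) (s : semidot V).
Implicit Types (x y z : V) (k : R[i]).

Lemma sdotDl x y z : s (x + y) z = s x z + s y z.
Proof. by have := sdot_linear s 1 x y z; rewrite scale1r mul1r. Qed.

Lemma sdot0l z : s 0 z = 0.
Proof. by apply: (addrI (s 0 z)); rewrite -sdotDl !addr0. Qed.

Lemma sdotZl k x z : s (k *: x) z = k * s x z.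
Proof. by have := sdot_linear s k x 0 z; rewrite addr0 sdot0l addr0. Qed.

Lemma sdotDr x y z : s z (x + y) = s z x + s z y.
Proof. by rewrite !(sdotC s z) sdotDl rmorphD. Qed.

Lemma sdotZr k x z : s z (k *: x) = k^* * s z x.
Proof. by rewrite !(sdotC s z) sdotZl rmorphM. Qed.

Lemma sdotNl x z : s (- x) z = - s x z.
Proof. by rewrite -scaleN1r sdotZl mulN1r. Qed.

Lemma sdotNr x z : s z (- x) = - s z x.
Proof. by rewrite !(sdotC s z) sdotNl rmorphN. Qed.

Lemma sdotBl x y z : s (x - y) z = s x z - s y z.
Proof. by rewrite sdotDl sdotNl. Qed.

Lemma sdotBr x y z : s z (x - y) = s z x - s z y.
Proof. by rewrite sdotDr sdotNr. Qed.

Lemma sdot_Im x : complex.Im (s x x) = 0.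
Proof. by have := sdotC s x x; case: (s x x) => a b /= [] /=; lra. Qed.

Definition rdot x y := complex.Re (s x y).

Lemma sdotxx x : s x x = (rdot x x)%:C.
Proof. by rewrite /rdot; have := sdot_Im x; case: (s x x) => a b /= ->. Qed.

Lemma rdotC x y : rdot x y = rdot y x.
Proof. by rewrite /rdot sdotC; case: (s y x). Qed.

Lemma rdotDl x y z : rdot (x + y) z = rdot x z + rdot y z.
Proof. by rewrite /rdot sdotDl raddfD. Qed.

Lemma rdotDr x y z : rdot z (x + y) = rdot z x + rdot z y.
Proof. by rewrite /rdot sdotDr raddfD. Qed.

Lemma rdotBl x y z : rdot (x - y) z = rdot x z - rdot y z.
Proof. by rewrite /rdot sdotBl raddfB. Qed.

Lemma rdotBr x y z : rdot z (x - y) = rdot z x - rdot z y.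
Proof. by rewrite /rdot sdotBr raddfB. Qed.

Lemma rdotZl (t : R) x y : rdot (t%:C *: x) y = t * rdot x y.
Proof.
by rewrite /rdot sdotZl; case: (s x y) => a b /=; rewrite mul0r subr0.
Qed.

(** Conjugate linearity in the second argument turns imaginary parts into real ones, so that
    estimates and limits need only be established for [rdot]. *)
Lemma Im_sdot x y : complex.Im (s x y) = rdot x ('i *: y).
Proof. by rewrite /rdot sdotZr; case: (s x y) => a b /=; lra. Qed.

Definition nrm x := Num.sqrt (rdot x x).

Lemma nrm_ge0 x : 0 <= nrm x.
Proof. exact: sqrtr_ge0. Qed.

Lemma nrm_sqr x : nrm x ^+ 2 = rdot x x.
Proof. by rewrite sqr_sqrtr//; exact: sdot_Re_ge0. Qed.

Lemma rdot_CS x y : `|rdot x y| <= nrm x * nrm y.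
Proof.
rewrite -ler_sqr ?nnegrE ?mulr_ge0 ?nrm_ge0// exprMn real_normK ?num_real//.
rewrite !nrm_sqr.
have quad t : 0 <= rdot y y + 2 * t * rdot x y + t ^+ 2 * rdot x x.
  have := sdot_Re_ge0 s (t%:C *: x + y); rewrite -/(rdot _ _).
  rewrite rdotDl !rdotDr !rdotZl ![rdot _ (_ *: _)]rdotC !rdotZl.
  by congr (_ <= _); ring.
have := sdot_Re_ge0 s x; rewrite -/(rdot x x) le_eqVlt => /predU1P[q0|q0].
  have [->|b0] := eqVneq (rdot x y) 0; first by rewrite -q0 expr0n mul0r.
  (* Without a quadratic term the expression is affine in t, and this t gives it the value -1. *)
  have := quad (- (rdot y y + 1) / (2 * rdot x y)); rewrite -q0 mulr0 addr0.
  have -> : 2 * (- (rdot y y + 1) / (2 * rdot x y)) * rdot x y =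
    - (rdot y y + 1) by field.
  by lra.
have q1 : rdot x x != 0 by rewrite gt_eqF.
have := quad (- rdot x y / rdot x x).
have -> : rdot y y + 2 * (- rdot x y / rdot x x) * rdot x y +
    (- rdot x y / rdot x x) ^+ 2 * rdot x x =
  (rdot x x * rdot y y - rdot x y ^+ 2) / rdot x x by field.
by rewrite pmulr_lge0 ?invr_gt0// subr_ge0.
Qed.

Lemma nrmD x y : nrm (x + y) <= nrm x + nrm y.
Proof.
rewrite -ler_sqr ?nnegrE ?addr_ge0 ?nrm_ge0// nrm_sqr.
rewrite sqrrD !nrm_sqr rdotDl !rdotDr (rdotC y x).
by have := ler_normlW (rdot_CS x y); lra.
Qed.

Lemma nrmZ k x : (nrm (k *: x))%:C = `|k| * (nrm x)%:C.
Proof.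
have nrm0 z : 0 <= (nrm z)%:C by rewrite ler0c nrm_ge0.
apply/eqP; rewrite -(@eqrXn2 _ 2) ?mulr_ge0//.
have nrmE z : (nrm z)%:C ^+ 2 = s z z by rewrite sdotxx -nrm_sqr rmorphXn.
by rewrite exprMn !nrmE sdotZl sdotZr mulrA -normCK.
Qed.

Lemma nrmN x : nrm (- x) = nrm x.
Proof. by rewrite /nrm /rdot sdotNl sdotNr opprK. Qed.

Lemma nrm_distC x y : nrm (x - y) = nrm (y - x).
Proof. by rewrite -nrmN opprB. Qed.

Lemma nrm_triangle y x z : nrm (x - z) <= nrm (x - y) + nrm (y - z).
Proof. by rewrite -(subrKA y x (- z)) nrmD. Qed.

Lemma nrm_eq0 x y : nrm x = 0 -> s x y = 0.
Proof.
move=> x0; apply/eqP; rewrite eq_complex Im_sdot -/(rdot x y) -!normr_le0.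
by apply/andP; split; rewrite (le_trans (rdot_CS _ _))// x0 mul0r.
Qed.

End SemidotTheory.

(** * Cauchy sequences and the functionals that they represent *)

Section Completion.
Variables (R : realType) (V : lmodType R[i]) (s : semidot V).
Implicit Types (u w : nat -> V) (v : V) (f g : V -> R[i]^o).

Definition cauchy_seq u := forall e : R, 0 < e ->
  exists N, forall n m, (N <= n)%N -> (N <= m)%N -> nrm s (u n - u m) <= e.

Definition represents u f :=
  cauchy_seq u /\ forall v, ccvg (fun n => s (u n) v) (f v).

Lemma cauchy_seq_bounded u : cauchy_seq u ->
  exists (B : R) N, 0 < B /\ forall n, (N <= n)%N -> nrm s (u n) <= B.
Proof.
move=> /(_ 1 ltr01)[N uN]; exists (nrm s (u N) + 1), N.
split=> [|n Nn]; first by rewrite ltr_wpDl ?nrm_ge0.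
rewrite -[u n](subrK (u N)); apply: le_trans (nrmD _ _ _) _.
by rewrite addrC lerD2l uN.
Qed.

Lemma cauchy_seq_cst v : cauchy_seq (fun=> v).
Proof.
move=> e e0; exists 0 => n m _ _.
by rewrite subrr /nrm /rdot sdot0l /= sqrtr0 ltW.
Qed.

Lemma cauchy_seqD u w : cauchy_seq u -> cauchy_seq w ->
  cauchy_seq (fun n => u n + w n).
Proof.
move=> uC wC e e0; have e2 : 0 < e / 2 by rewrite divr_gt0.
have [[N uN] [M wM]] := (uC _ e2, wC _ e2).
exists (maxn N M) => n m; rewrite !geq_max => /andP[Nn Mn] /andP[Nm Mm].
rewrite opprD addrACA (le_trans (nrmD _ _ _))//.
by have := uN _ _ Nn Nm; have := wM _ _ Mn Mm; lra.
Qed.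

Lemma cauchy_seq_map (h : V -> V) (M : R) u :
  {morph h : x y / x - y} -> (forall v, nrm s (h v) <= M * nrm s v) ->
  cauchy_seq u -> cauchy_seq (h \o u).
Proof.
(* [M] may be zero or negative, hence a positive constant above it. *)
move=> hB hM uC e e0; pose M' := `|M| + 1.
have M0 : 0 < M' by rewrite ltr_wpDl.
have [N uN] := uC _ (divr_gt0 e0 M0); exists N => n m Nn Nm /=.
rewrite -hB (le_trans (hM _))//.
have := uN _ _ Nn Nm; rewrite ler_pdivlMr// mulrC; apply: le_trans.
by rewrite ler_wpM2r ?nrm_ge0// (le_trans (ler_norm _))// lerDl.
Qed.

Lemma cauchy_seqZ (k : R[i]) u : cauchy_seq u -> cauchy_seq (fun n => k *: u n).
Proof.
apply: (@cauchy_seq_map ( *:%R k) (complex.Re `|k|)) => [x y|v].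
  exact: scalerBr.
have kE : (complex.Re `|k|)%:C = `|k| by rewrite RRe_real ?ger0_real.
by rewrite -lecR nrmZ -kE -rmorphM.
Qed.

Lemma cauchy_seq_rdot u w : cauchy_seq u -> cauchy_seq w ->
  exists l : R, (fun n => rdot s (u n) (w n)) @ \oo --> l.
Proof.
move=> uC wC; apply: cauchy_seq_cvg => e e0.
have [B [N [B0 uB]]] := cauchy_seq_bounded uC.
have [B' [N' [B'0 wB]]] := cauchy_seq_bounded wC.
have BB : 0 < B + B' by exact: addr_gt0.
have [[M uM] [M' wM]] := (uC _ (divr_gt0 e0 BB), wC _ (divr_gt0 e0 BB)).
exists (maxn (maxn N N') (maxn M M')) => n m; rewrite !geq_max.
move=> /andP[/andP[Nn N'n] /andP[Mn M'n]] /andP[/andP[Nm N'm] /andP[Mm M'm]].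
have -> : rdot s (u n) (w n) - rdot s (u m) (w m) =
    rdot s (u n - u m) (w n) + rdot s (u m) (w n - w m).
  by rewrite rdotBl rdotBr addrA subrK.
apply: le_trans (ler_normD _ _) _.
have -> : e = e / (B + B') * B' + B * (e / (B + B')) by field; rewrite gt_eqF.
by apply: lerD; apply: le_trans (rdot_CS _ _ _) _;
  apply: ler_pM; rewrite ?nrm_ge0//; auto.
Qed.

Lemma cauchy_seq_sdot u w : cauchy_seq u -> cauchy_seq w ->
  exists l, ccvg (fun n => s (u n) (w n)) l.
Proof.
move=> uC wC; have [a au] := cauchy_seq_rdot uC wC.
have [b bu] := cauchy_seq_rdot uC (cauchy_seqZ 'i wC).
exists (a +i* b); split=> //=.
by under eq_fun do rewrite Im_sdot.
Qed.

(** Since w is bounded, <u_n - u_m, w_m> is small for all large n and m, so the iterated limit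
    agrees with the diagonal one. This allows an inner product to be computed from one functional
    and a sequence for the other. *)
Lemma iterated_rdot_cvg u w (g : nat -> R) (l : R) :
  cauchy_seq u -> cauchy_seq w ->
  (forall m, (fun n => rdot s (u n) (w m)) @ \oo --> g m) ->
  (fun n => rdot s (u n) (w n)) @ \oo --> l -> g @ \oo --> l.
Proof.
move=> uC wC ug uwl; apply/cvgrPdist_le => e e0.
have [B [N [B0 wB]]] := cauchy_seq_bounded wC.
have e2 : 0 < e / 2 by rewrite divr_gt0.
have [M uM] := uC _ (divr_gt0 e2 B0).
have /cvgrPdist_le/(_ _ e2)[N' _ N'P] := uwl.
exists (maxn N (maxn M N')) => // m /=; rewrite !geq_max => /and3P[Nm Mm N'm].
have gm : `|g m - rdot s (u m) (w m)| <= e / 2.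
  have h : (fun n => `|rdot s (u n) (w m) - rdot s (u m) (w m)|) @ \oo
      --> `|g m - rdot s (u m) (w m)|.
    by apply: cvg_norm; apply: cvgB => //; exact: cvg_cst.
  rewrite -(cvg_lim _ h)//; apply: limr_le.
    by apply/cvg_ex; eexists; exact: h.
  exists M => // n /= Mn; rewrite -rdotBl; apply: le_trans (rdot_CS _ _ _) _.
  have -> : e / 2 = e / 2 / B * B by field; rewrite gt_eqF.
  by apply: ler_pM; rewrite ?nrm_ge0//; auto.
have := N'P _ N'm => /= h.
rewrite -[l](subrK (rdot s (u m) (w m))) -addrA.
apply: le_trans (ler_normD _ _) _.
by move: gm h; rewrite (distrC (g m)); lra.
Qed.

Lemma represents_cvg u w f l : represents u f -> cauchy_seq w ->
  ccvg (fun n => s (u n) (w n)) l -> ccvg (fun n => f (w n)) l.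
Proof.
move=> [uC uf] wC [lr li]; split.
  by apply: (iterated_rdot_cvg uC wC) => // m; have [] := uf (w m).
apply: (iterated_rdot_cvg uC (cauchy_seqZ 'i wC)) => [m|].
  have [_] := uf (w m).
  by under eq_fun do rewrite Im_sdot.
by under eq_fun do rewrite -Im_sdot.
Qed.

Lemma represents_lin u w f g (k : R[i]) : represents u f -> represents w g ->
  represents (fun n => k *: u n + w n) (k *: f + g).
Proof.
move=> [uC uf] [wC wg]; split=> [|v].
  by apply: cauchy_seqD => //; exact: cauchy_seqZ.
under eq_fun do rewrite sdotDl sdotZl.
by apply: ccvgD => //; exact: ccvgZ.
Qed.

Lemma represents_cst v : represents (fun=> v) (s v).
Proof. by split=> [|w]; [exact: cauchy_seq_cst|exact: ccvg_cst]. Qed.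

(** With functionals as points, equality of functions is already the right equality: Cauchy
    sequences whose distance tends to zero represent the same function and null vectors of V become
    0, so no quotient is formed. *)
Definition completion_pred : {pred V -> R[i]^o} :=
  fun f => `[< exists u, represents u f >].

Lemma completion_submod : GRing.submod_closed completion_pred.
Proof.
split=> [|k f g /asboolP[u uf] /asboolP[w wg]]; apply/asboolP.
  exists (fun=> 0); suff -> : 0 = s 0 :> (V -> R[i]^o) by exact: represents_cst.
  by apply/funext => v; rewrite sdot0l.
by exists (fun n => k *: u n + w n); exact: represents_lin.
Qed.

HB.instance Definition _ :=
  GRing.isSubmodClosed.Build R[i] (V -> R[i]^o) completion_pred
    completion_submod.

Record completion := Completion {
  completion_fun :> V -> R[i]^o;
  completion_funP : completion_fun \in completion_pred
}.

HB.instance Definition _ := [isSub for completion_fun].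
HB.instance Definition _ := [Choice of completion by <:].
HB.instance Definition _ := [SubChoice_isSubLmodule of completion by <:].

Implicit Types F G : completion.

Lemma completionP F G : F =1 G -> F = G.
Proof. by move=> FG; apply/val_inj/funext. Qed.

Lemma completion_rep F : exists u, represents u F.
Proof. by case: F => f /= /asboolP. Qed.

Definition rep F := projT1 (cid (completion_rep F)).

Lemma repP F : represents (rep F) F.
Proof. exact: (projT2 (cid (completion_rep F))). Qed.

Lemma cdot_subproof F G :
  exists l, ccvg (fun n => s (rep F n) (rep G n)) l.
Proof. by apply: cauchy_seq_sdot; [case: (repP F)|case: (repP G)]. Qed.

Definition cdot F G := projT1 (cid (cdot_subproof F G)).

(** The diagonal limit is also the limit of the functional F along the second sequence, which
    depends on the first sequence only through F. Representatives can thus be exchanged one at a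
    time, the second after conjugation. *)
Lemma cdotP u w F G : represents u F -> represents w G ->
  ccvg (fun n => s (u n) (w n)) (cdot F G).
Proof.
move=> uF wG; have [uC wC] := (uF.1, wG.1).
have rG := repP G; have [l lP] := cauchy_seq_sdot uC rG.1.
have F1 := represents_cvg (repP F) rG.1 (projT2 (cid (cdot_subproof F G))).
have F2 := represents_cvg uF rG.1 lP.
rewrite /cdot (ccvg_unique F1 F2).
have [l' l'P] := cauchy_seq_sdot uC wC.
have conjP w' a : ccvg (fun n => s (u n) (w' n)) a ->
    ccvg (fun n => s (w' n) (u n)) a^*.
  by move=> /ccvg_conj; under eq_fun do rewrite -sdotC.
have G1 := represents_cvg rG uC (conjP _ _ lP).
have G2 := represents_cvg wG uC (conjP _ _ l'P).
by rewrite (can_inj (@conjcK R) (ccvg_unique G1 G2)).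
Qed.

End Completion.

Section CompletionHilbert.
Variables (R : realType) (V : lmodType R[i]) (s : semidot V).
Implicit Types (F G : completion s) (v : V).

Lemma completion_funE (k : R[i]) F G :
  completion_fun (k *: F + G) = k *: completion_fun F + completion_fun G.
Proof. by []. Qed.

Lemma completion_lin (u w : nat -> V) (k : R[i]) F G :
  represents s u F -> represents s w G ->
  represents s (fun n => k *: u n + w n) (k *: F + G).
Proof. by rewrite completion_funE; exact: represents_lin. Qed.

Fact cdot_linear (k : R[i]) F G H :
  cdot (k *: F + G) H = k * cdot F H + cdot G H.
Proof.
have [rF rG] := (repP F, repP G).
apply: ccvg_unique (cdotP (completion_lin k rF rG) (repP H)) _.
under eq_fun do rewrite sdotDl sdotZl.
by apply: ccvgD; [apply: ccvgZ|]; exact: cdotP (repP _) (repP _).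
Qed.

Fact cdotC F G : cdot F G = (cdot G F)^*.
Proof.
apply: ccvg_unique (cdotP (repP F) (repP G)) _.
under eq_fun do rewrite sdotC.
exact/ccvg_conj/cdotP/repP/repP.
Qed.

Fact cdot_Re_ge0 F : 0 <= complex.Re (cdot F F).
Proof.
by apply: ccvg_Re_ge0 (cdotP (repP F) (repP F)) => n; exact: sdot_Re_ge0.
Qed.

Definition csdot := Semidot cdot_linear cdotC cdot_Re_ge0.

Lemma represents_mem (u : nat -> V) (f : V -> R[i]^o) :
  represents s u f -> f \in completion_pred s.
Proof. by move=> uf; apply/asboolP; exists u. Qed.

Definition cembed v := Completion (represents_mem (represents_cst s v)).

Lemma cembedP v : represents s (fun=> v) (cembed v).
Proof. exact: represents_cst. Qed.

(** A reproducing property: it makes the embedding of V isometric and, through Cauchy-Schwarz, the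
    seminorm definite. *)
Lemma cdot_embedr F v : cdot F (cembed v) = F v.
Proof.
apply: ccvg_unique (cdotP (repP F) (cembedP v)) _.
by have [] := repP F.
Qed.

Lemma cembedB v w : cembed (v - w) = cembed v - cembed w.
Proof. by apply: completionP => x; exact: sdotBl. Qed.

Lemma nrm_cembed v : nrm csdot (cembed v) = nrm s v.
Proof. by rewrite /nrm /rdot /= cdot_embedr. Qed.

Lemma completion_nrm0 F : nrm csdot F = 0 -> F = 0.
Proof.
move=> F0; apply: completionP => v; rewrite -cdot_embedr.
exact: (nrm_eq0 (s := csdot)).
Qed.

Lemma represents_nrm_le (u : nat -> V) F (M : R) : 0 <= M ->
  represents s u F -> (\forall n \near \oo, nrm s (u n) <= M) ->
  nrm csdot F <= M.
Proof.
move=> M0 uF uM; rewrite -ler_sqr ?nnegrE ?nrm_ge0// nrm_sqr.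
have [h _] := cdotP uF uF.
rewrite /rdot /= -(cvg_lim _ h)//; apply: limr_le.
  by apply/cvg_ex; eexists; exact: h.
apply: filterS uM => n unM.
by rewrite -/(rdot s (u n) (u n)) -nrm_sqr ler_sqr ?nnegrE ?nrm_ge0.
Qed.

Lemma represents_dist (u : nat -> V) F (e : R) : represents s u F -> 0 < e ->
  exists N, forall n, (N <= n)%N -> nrm csdot (F - cembed (u n)) <= e.
Proof.
move=> uF e0; have [N uN] := uF.1 _ e0; exists N => n Nn.
(* The difference is represented by the sequence m |-> u m - u n, whose tail is small. *)
have := completion_lin (-1) (cembedP (u n)) uF.
rewrite !scaleN1r (addrC (- cembed (u n))) => h.
apply: (represents_nrm_le (ltW e0) h).
by exists N => // m /= Nm; rewrite addrC; exact: uN.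
Qed.

Let cnorm F : R[i] := (nrm csdot F)%:C.

Fact cnormD F G : cnorm (F + G) <= cnorm F + cnorm G.
Proof. by rewrite -rmorphD lecR; exact: nrmD. Qed.

Fact cnormZ (k : R[i]) F : cnorm (k *: F) = `|k| * cnorm F.
Proof. exact: nrmZ. Qed.

Fact cnorm_eq0 F : cnorm F = 0 -> F = 0.
Proof. by move=> /eqP; rewrite fmorph_eq0 => /eqP/completion_nrm0. Qed.

HB.instance Definition _ := Lmodule_isNormed.Build R[i] (completion s)
  cnormD cnormZ cnorm_eq0.

End CompletionHilbert.

Section CompletionComplete.
Variables (R : realType) (V : lmodType R[i]) (s : semidot V).
Implicit Types (F G : completion s) (v : V).

Lemma completion_normE F : `|F| = (nrm (csdot s) F)%:C.
Proof. by []. Qed.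

Lemma completion_ballE F (e : R) G :
  ball F e%:C G = (nrm (csdot s) (F - G) < e).
Proof. by rewrite -ball_normE /ball_/= completion_normE ltcR. Qed.

Lemma cauchy_seq_repr (u : nat -> V) : cauchy_seq s u ->
  exists F, represents s u F.
Proof.
move=> uC; have /choice[f fP] : forall v, exists l, ccvg (fun n => s (u n) v) l.
  by move=> v; exact: (cauchy_seq_sdot uC (cauchy_seq_cst s v)).
have uf : represents s u f by [].
by exists (Completion (represents_mem uf)).
Qed.

(** The filter contains balls with centres x n and radii 1/(n+1), and each x n is approximated by an
    embedded vector v n. The sequence v is Cauchy because any two of the balls meet, and the
    functional that it represents is the limit. *)
Fact completion_complete (F : set_system (completion s)) :
  ProperFilter F -> cauchy F -> cvg F.
Proof.
move=> FF /cauchyP Fex.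
have inv0 n : 0 < n.+1%:R^-1 :> R by rewrite invr_gt0.
have /choice[x xP] : forall n, exists x, F (ball x (n.+1%:R^-1 : R)%:C).
  by move=> n; apply: Fex; rewrite ltcR.
have /choice[v vP] : forall n, exists v,
    nrm (csdot s) (x n - cembed s v) <= n.+1%:R^-1.
  move=> n; have [N h] := represents_dist (repP (x n)) (inv0 n).
  have {}h := h N (leqnn N); by exists (rep (x n) N).
have vC : cauchy_seq s v.
  move=> e e0.
  have e4 : 0 < e / 4 by rewrite divr_gt0.
  have [N _ NP] := near_infty_natSinv_lt (PosNum e4).
  exists N => n m /NP/= n4 /NP/= m4.
  rewrite -nrm_cembed cembedB.
  have [y [/= ny my]] := filter_ex (filterI (xP n) (xP m)).
  rewrite !completion_ballE in ny my.
  have vy k : nrm (csdot s) (x k - y) < k.+1%:R^-1 ->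
      nrm (csdot s) (cembed s (v k) - y) <= k.+1%:R^-1 + k.+1%:R^-1.
    move=> ky; apply: le_trans (nrm_triangle _ (x k) _ _) _.
    by apply: lerD; [rewrite nrm_distC; exact: vP|exact: ltW].
  apply: le_trans (nrm_triangle _ y _ _) _.
  (* Four distances add up: from v n to x n, y, x m and v m, with y in both balls. *)
  apply: (@le_trans _ _ (e / 4 + e / 4 + (e / 4 + e / 4))); last first.
    by clear; lra.
  rewrite lerD//; first by rewrite (le_trans (vy _ ny))// lerD// ltW.
  by rewrite nrm_distC (le_trans (vy _ my))// lerD// ltW.
have [G vG] := cauchy_seq_repr vC.
apply/cvg_ex; exists G; apply/fcvg_ballP => e e0.
have eE : e = (complex.Re e)%:C by rewrite RRe_real// ger0_real// ltW.
have r0 : 0 < complex.Re e by rewrite -ltcR -eE.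
have r3 : 0 < complex.Re e / 3 by rewrite divr_gt0.
rewrite eE; move: (complex.Re e) r0 r3 => r r0 r3.
have [N NP] := represents_dist vG r3.
have [M _ MP] := near_infty_natSinv_lt (PosNum r3).
pose n := maxn N M; apply: filterS (xP n) => y; rewrite !completion_ballE => xy.
have := MP n (leq_maxr _ _); have := NP n (leq_maxl _ _) => /= h1 h2.
apply: le_lt_trans (nrm_triangle _ (cembed s (v n)) _ _) _.
have -> : r = r / 3 + (r / 3 + r / 3) by field.
apply: ler_ltD; first exact: h1.
apply: le_lt_trans (nrm_triangle _ (x n) _ _) _.
apply: ltrD; last exact: lt_trans xy h2.
by rewrite nrm_distC; exact: le_lt_trans (vP n) h2.
Qed.

HB.instance Definition _ :=
  Uniform_isComplete.Build (completion s) completion_complete.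

Fact cdot_bilinear : bilinear_for *%R (Num.conj \; *%R) (@cdot R V s).
Proof.
split=> F k G H; first exact: cdot_linear.
rewrite -[LHS]/(csdot s F (k *: G + H)) sdotDr sdotZr.
by [].
Qed.

HB.instance Definition _ :=
  bilinear_isBilinear.Build R[i] (completion s) (completion s) R[i]
    *%R (Num.conj \; *%R) (@cdot R V s) cdot_bilinear.

Fact cdot_hermitian F G : cdot F G = (-1) ^+ false * Num.conj (cdot G F).
Proof. by rewrite mul1r; exact: cdotC. Qed.

HB.instance Definition _ :=
  isHermitianSesquilinear.Build R[i] (completion s) false Num.conj
    (@cdot R V s) cdot_hermitian.

Fact cdot_gt0 F : F != 0 -> 0 < cdot F F.
Proof.
move=> F0; rewrite -[cdot F F]/(csdot s F F) sdotxx ltcR -nrm_sqr.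
rewrite exprn_gt0// lt_def nrm_ge0 andbT.
by apply: contra_neq F0; exact: completion_nrm0.
Qed.

HB.instance Definition _ :=
  isDotProduct.Build R[i] (completion s) (@cdot R V s) cdot_gt0.

Fact cdot_norm F : cdot F F = `|F| ^+ 2.
Proof.
by rewrite completion_normE -rmorphXn nrm_sqr -[cdot F F]/(csdot s F F) sdotxx.
Qed.

HB.instance Definition _ :=
  CompleteNormedModule_isHilbert.Build R (completion s) cdot_norm.

Lemma completion_hdotE F G : hdot F G = csdot s F G.
Proof. by []. Qed.
End CompletionComplete.

Lemma star1 (R : realType) (A : starAlgType R) : star 1 = 1 :> A.
Proof. by rewrite -[RHS]starK -[star 1 in RHS]mul1r starM starK mul1r. Qed.

(** * Passage of an action to the completion *)

Section CompletionRepresentation.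
Variables (R : realType) (A : starAlgType R) (V : lmodType R[i]).
Variables (s : semidot V) (rho : A -> V -> V).
Hypothesis rho_linl : forall (k : R[i]) a b v,
  rho (k *: a + b) v = k *: rho a v + rho b v.
Hypothesis rho_linr : forall a (k : R[i]) v w,
  rho a (k *: v + w) = k *: rho a v + rho a w.
Hypothesis rhoM : forall a b v, rho (a * b) v = rho a (rho b v).
Hypothesis rho1 : forall v, rho 1 v = v.
Hypothesis rho_star : forall a v w, s (rho a v) w = s v (rho (star a) w).
Hypothesis rho_bounded : forall a,
  exists M : R, forall v, nrm s (rho a v) <= M * nrm s v.

Lemma completion_conjlin (F : completion s) (k : R[i]) v w :
  F (k *: v + w) = k^* * F v + F w.
Proof.
have [_ uF] := repP F; apply: ccvg_unique (uF _) _.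
by under eq_fun do rewrite sdotDr sdotZr; apply: ccvgD => //; exact: ccvgZ.
Qed.

Let rhoB a : {morph rho a : v w / v - w}.
Proof.
by move=> v w; rewrite addrC -scaleN1r rho_linr scaleN1r addrC.
Qed.

Lemma represents_rho a u (f : V -> R[i]^o) : represents s u f ->
  represents s (rho a \o u) (f \o rho (star a)).
Proof.
move=> [uC uf]; split=> [|v].
  by have [M rM] := rho_bounded a; exact: (cauchy_seq_map (rhoB a) rM).
by under eq_fun do rewrite /= rho_star; exact: uf.
Qed.

Definition crho a (F : completion s) : completion s :=
  Completion (represents_mem (represents_rho a (repP F))).

Lemma crhoP a u (F : completion s) :
  represents s u F -> represents s (rho a \o u) (crho a F).
Proof. exact: represents_rho. Qed.

Lemma crho_bounded a : crho a \in @bounded_linear R (completion s).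
Proof.
apply/asboolP; split=> [k F G|]; first exact: completionP.
have [M rM] := rho_bounded a; exists `|M| => F.
rewrite !completion_normE -rmorphM lecR -ler_sqr ?nnegrE ?mulr_ge0 ?nrm_ge0//.
rewrite exprMn !nrm_sqr real_normK; last exact: num_real.
have rF := repP F; have raF := crhoP a rF.
have [h _] := cdotP raF raF; have [h' _] := cdotP rF rF.
have h'' : (fun n => M ^+ 2 * rdot s (rep F n) (rep F n)) @ \oo
    --> M ^+ 2 * rdot (csdot s) F F.
  by apply: cvgM => //; exact: cvg_cst.
apply: ler_cvg_to h h'' _; apply: nearW => n.
rewrite -/(rdot s _ _) -!nrm_sqr -exprMn -(real_normK (num_real (M * _))).
rewrite ler_sqr ?nnegrE ?nrm_ge0//.
exact: le_trans (rM _) (ler_norm _).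
Qed.

Definition crep a : bop (completion s) := Bop (crho_bounded a).

Lemma crep_star_representation : star_representation crep.
Proof.
split.
- move=> k a b; apply: bopP => F; apply: completionP => v /=.
  rewrite starD starZ rho_linl.
  by rewrite completion_conjlin; congr (_ * _ + _); exact: conjcK.
- move=> a b; apply: bopP => F; apply: completionP => v /=.
  by rewrite starM rhoM.
- move=> a; apply: bopP => F; apply: hdot_ext => G.
  rewrite -[star (crep a)]/(bop_adj (crep a)) -bop_adjP.
  have [rF rG] := (repP F, repP G).
  apply: ccvg_unique (cdotP rG (crhoP (star a) rF)) _.
  under eq_fun do rewrite /= -rho_star.
  exact: (cdotP (crhoP a rG) rF).
Qed.

Lemma crep1 : crep 1 = 1.
Proof.
apply: bopP => F; apply: completionP => v /=.
by rewrite star1 rho1.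
Qed.

(** Embedded vectors give one direction. For the other, the form at a vector of the completion is
    the limit of the forms at representing sequences, and nonnegativity passes to the limit. *)
Lemma crep_positive n (Z : 'M[A]_n) :
  mxop_positive (map_mx crep Z) <->
  forall w : 'I_n -> V, 0 <= \sum_i \sum_j s (rho (Z i j) (w j)) (w i).
Proof.
have dsumE (F : 'I_n -> completion s) :
    dsum_hdot (mxop (map_mx crep Z) F) F =
    \sum_i \sum_j cdot (crho (Z i j) (F j)) (F i).
  apply: eq_bigr => i _; rewrite completion_hdotE.
  rewrite /mxop (big_morph _ (fun x y => sdotDl (csdot s) x y (F i))
    (sdot0l (csdot s) (F i))).
  by apply: eq_bigr => j _; rewrite mxE.
split=> [ZP w|ZP F].
  have := ZP (fun i => cembed s (w i)); rewrite dsumE.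
  congr (0 <= _); apply: eq_bigr => i _; apply: eq_bigr => j _.
  by rewrite cdot_embedr /= rho_star.
rewrite dsumE.
apply: (@ccvg_ge0 _ (fun n => \sum_i \sum_j
  s (rho (Z i j) (rep (F j) n)) (rep (F i) n))) => [m|]; first exact: ZP.
apply: ccvg_sum => i; apply: ccvg_sum => j.
exact: cdotP (crhoP _ (repP _)) (repP _).
Qed.

(** Hides the construction: what follows uses only that positivity of operator matrices can be
    tested on V. *)
Lemma completion_representation : exists (H : hilbertType R) (tau : A -> bop H),
  [/\ star_representation tau, tau 1 = 1 & forall n (Z : 'M[A]_n),
  mxop_positive (map_mx tau Z) <->
  forall w : 'I_n -> V, 0 <= \sum_i \sum_j s (rho (Z i j) (w j)) (w i)].
Proof.
exists (completion s), crep; split.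
- exact: crep_star_representation.
- exact: crep1.
- exact: crep_positive.
Qed.

End CompletionRepresentation.

(** * Operator matrices *)

(** Polarisation: x + y settles the imaginary parts and ix + y the real parts. *)
Lemma sesquilinear_hermitian (R : realType) (V : lmodType R[i])
    (B : V -> V -> R[i]) :
  (forall k x y z, B (k *: x + y) z = k * B x z + B y z) ->
  (forall k x y z, B z (k *: x + y) = k^* * B z x + B z y) ->
  (forall x, complex.Im (B x x) = 0) -> forall x y, B x y = (B y x)^*.
Proof.
move=> Bl Br B0 x y.
have h1 := B0 (1 *: x + y); have h2 := B0 ('i *: x + y).
rewrite Bl !Br in h1; rewrite Bl !Br in h2.
move: h1 h2 (B0 x) (B0 y).
case: (B x x) (B x y) (B y x) (B y y) => [a a'] [b b'] [c c'] [d d'] /=.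
move=> h1 h2 h3 h4; apply/eqP; rewrite eq_complex /=.
by apply/andP; split; apply/eqP; lra.
Qed.

Section OperatorMatrices.
Variables (R : realType) (H : hilbertType R).
Implicit Types (m n p : nat).

(** The rectangular form of [mxop], convertible to it on square matrices; congruences by rectangular
    matrices require it. *)
Definition mxapp m n (X : 'M[bop H]_(m, n)) (v : 'I_n -> H) : 'I_m -> H :=
  fun i => \sum_j X i j (v j).

Lemma hdot0l (x : H) : hdot 0 x = 0.
Proof. by rewrite -(subrr x) hdotBl subrr. Qed.

Lemma hdot0r (x : H) : hdot x 0 = 0.
Proof. by rewrite -(subrr x) hdotBr subrr. Qed.

Lemma hdot_suml (I : Type) (r : seq I) (F : I -> H) x :
  hdot (\sum_(i <- r) F i) x = \sum_(i <- r) hdot (F i) x.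
Proof.
apply: (big_morph (fun y => hdot y x)) => [y z|]; first exact: hdotDl.
exact: hdot0l.
Qed.

Lemma hdot_sumr (I : Type) (r : seq I) (F : I -> H) x :
  hdot x (\sum_(i <- r) F i) = \sum_(i <- r) hdot x (F i).
Proof.
by apply: (big_morph (hdot x)) => [y z|]; [exact: hdotDr|exact: hdot0r].
Qed.

Lemma bop_sum (T : bop H) (I : Type) (r : seq I) (F : I -> H) :
  T (\sum_(i <- r) F i) = \sum_(i <- r) T (F i).
Proof. by apply: big_morph => [y z|]; [exact: bop_linearD|exact: bop0r]. Qed.

Lemma bop_sumE (I : Type) (r : seq I) (F : I -> bop H) (x : H) :
  (\sum_(i <- r) F i) x = \sum_(i <- r) F i x.
Proof. by apply: (big_morph (fun T : bop H => T x)). Qed.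

Lemma dsum_hdot_mxapp m n (X : 'M[bop H]_(m, n)) v w :
  dsum_hdot (mxapp X v) w = \sum_i \sum_j hdot (X i j (v j)) (w i).
Proof. by apply: eq_bigr => i _; exact: hdot_suml. Qed.

Lemma mxapp_adj m n (X : 'M[bop H]_(m, n)) v w :
  dsum_hdot (mxapp (adjmx X) v) w = dsum_hdot v (mxapp X w).
Proof.
rewrite dsum_hdot_mxapp exchange_big; apply: eq_bigr => j _.
rewrite hdot_sumr; apply: eq_bigr => i _.
by rewrite !mxE -[star _]/(bop_adj _) bop_adjP bop_adjK.
Qed.

Lemma mxapp_mul m n p (X : 'M[bop H]_(m, n)) (Y : 'M[bop H]_(n, p)) v :
  mxapp (X *m Y) v = mxapp X (mxapp Y v).
Proof.
apply/funext => i; rewrite /mxapp; under [RHS]eq_bigr do rewrite bop_sum.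
by rewrite exchange_big; apply: eq_bigr => k _; rewrite mxE bop_sumE.
Qed.

Lemma dsum_hdot_linl n k (v w u : 'I_n -> H) :
  dsum_hdot (k *: v + w) u = k * dsum_hdot v u + dsum_hdot w u.
Proof.
rewrite mulr_sumr -big_split; apply: eq_bigr => i _ /=.
by rewrite -hdotZl -hdotDl.
Qed.

Lemma dsum_hdot_linr n k (v w u : 'I_n -> H) :
  dsum_hdot u (k *: v + w) = k^* * dsum_hdot u v + dsum_hdot u w.
Proof.
rewrite mulr_sumr -big_split; apply: eq_bigr => i _ /=.
by rewrite -hdotZr -hdotDr.
Qed.

Lemma mxapp_lin m n (X : 'M[bop H]_(m, n)) k v w :
  mxapp X (k *: v + w) = k *: mxapp X v + mxapp X w.
Proof.
apply/funext => i; rewrite -[RHS]/(k *: mxapp X v i + mxapp X w i).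
rewrite scaler_sumr -big_split; apply: eq_bigr => j _ /=.
by rewrite -bop_linear.
Qed.

Definition single n (i : 'I_n) (x : H) : 'I_n -> H :=
  fun j => if j == i then x else 0.

Lemma dsum_hdot_single m n (X : 'M[bop H]_(m, n)) i j x y :
  dsum_hdot (mxapp X (single j x)) (single i y) = hdot (X i j x) y.
Proof.
rewrite dsum_hdot_mxapp (bigD1 i)//= [X in _ + X]big1 => [|k /negPf ki].
  rewrite addr0 (bigD1 j)//= [X in _ + X]big1 => [|k /negPf kj].
    by rewrite addr0 /single !eqxx.
  by rewrite /single kj bop0r hdot0l.
by rewrite big1// => l _; rewrite /single ki hdot0r.
Qed.

Lemma mxop_real_hermitian n (X : 'M[bop H]_n) :
  (forall v, complex.Im (dsum_hdot (mxop X v) v) = 0) ->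
  forall v w, dsum_hdot (mxop X v) w = (dsum_hdot (mxop X w) v)^*.
Proof.
move=> X0; apply: (@sesquilinear_hermitian _ ('I_n -> H)
  (fun v w => dsum_hdot (mxapp X v) w)) => // [k u v w|k u v w].
  by rewrite mxapp_lin dsum_hdot_linl.
exact: dsum_hdot_linr.
Qed.

Lemma mxop_positive_adjmx n (X : 'M[bop H]_n) :
  mxop_positive X -> adjmx X = X.
Proof.
move=> X0; apply/matrixP => i j; rewrite !mxE; apply: bopP => x.
apply: hdot_ext => z; rewrite -[star _]/(bop_adj _) -bop_adjP.
rewrite -!dsum_hdot_single (@mxop_real_hermitian _ X).
  by rewrite dsum_hdot_single -hdotC.
by move=> v; have := X0 v; rewrite lecE => /andP[/eqP].
Qed.

(** By polarisation Re <Xv, w> vanishes for all v and w; replacing w by iw removes the imaginary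
    part. This gives the properness of the cones of a subalgebra. *)
Lemma mxop_zero n (X : 'M[bop H]_n) :
  (forall v, dsum_hdot (mxop X v) v = 0) -> X = 0.
Proof.
move=> X0; have herm := @mxop_real_hermitian n X (fun v => congr1 _ (X0 v)).
have X0' v : dsum_hdot (mxapp X v) v = 0 := X0 v.
have re0 v w : complex.Re (dsum_hdot (mxapp X v) w) = 0.
  have := X0' (1 *: v + w); rewrite mxapp_lin.
  rewrite dsum_hdot_linl !dsum_hdot_linr !X0'.
  rewrite [dsum_hdot _ v](herm w v).
  by case: (dsum_hdot _ _) => a b [] /=; lra.
apply/matrixP => i j; rewrite mxE; apply: bopP => x; apply: hdot_ext => z.
rewrite hdotC [RHS]hdotC; congr (_^*); rewrite hdot0l -dsum_hdot_single.
apply/eqP; rewrite eq_complex re0 eqxx /=; apply/eqP.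
move: (single j x) (single i z) => v w.
have := re0 v ('i *: w + 0); rewrite dsum_hdot_linr.
have -> : dsum_hdot (mxapp X v) 0 = 0.
  by rewrite /dsum_hdot big1// => k _; exact: hdot0r.
by rewrite addr0; case: (dsum_hdot _ _) => a b /=; lra.
Qed.

(** Expanding the square of T x + y bounds 2 Re <T x, y> below by minus the squared norms of T x and
    y. In [M + 1] the first summand pays for T x and the second for y. *)
Lemma Re_hdot_bop_ge (T : bop H) : exists2 M : R, 0 <= M & forall x y,
  - (M * (complex.Re (hdot x x) + complex.Re (hdot y y))) <=
    complex.Re (hdot (T x) y).
Proof.
have [M M0 TM] := bop_Re_bounded T; exists (M + 1) => [|x y]; first lra.
have q0 (z : H) : 0 <= complex.Re (hdot z z) by rewrite Re_hdotxx sqr_ge0.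
have := TM x; rewrite -!Re_hdotxx => h.
have := q0 (T x + y); rewrite hdotDl !hdotDr (hdotC y (T x)) => h'.
have {}h' : 0 <= complex.Re (hdot (T x) (T x)) +
    2 * complex.Re (hdot (T x) y) + complex.Re (hdot y y).
  move: h'; rewrite !raddfD /=; case: (hdot (T x) y) => a b /=; lra.
have := q0 x; have := q0 y; move: h h'.
move: (complex.Re _) (complex.Re _) (complex.Re _) (complex.Re _) => a b c d.
nra.
Qed.

Lemma mxop_lower_bound n (X : 'M[bop H]_n) : exists2 r : R, 0 < r &
  forall v, - r * complex.Re (dsum_hdot v v) <=
    complex.Re (dsum_hdot (mxop X v) v).
Proof.
have /choice[M MP] : forall ij : 'I_n * 'I_n, exists M : R, 0 <= M /\
    forall x y, - (M * (complex.Re (hdot x x) + complex.Re (hdot y y))) <=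
      complex.Re (hdot (X ij.1 ij.2 x) y).
  by move=> ij; have [M M0 MP] := Re_hdot_bop_ge (X ij.1 ij.2); exists M.
(* Each entry involves two coordinates of v, both bounded by <v, v>, hence the factor 2; the summand
   1 makes r positive even if every [M] is 0. *)
exists (1 + \sum_i \sum_j (M (i, j) *+ 2)) => [|v].
  rewrite ltr_pwDl// sumr_ge0// => i _; rewrite sumr_ge0// => j _.
  by rewrite mulrn_wge0//; case: (MP (i, j)).
have q0 (z : H) : 0 <= complex.Re (hdot z z) by rewrite Re_hdotxx sqr_ge0.
have Q i : complex.Re (hdot (v i) (v i)) <= complex.Re (dsum_hdot v v).
  rewrite /dsum_hdot (bigD1 i)//= raddfD /= lerDl raddf_sum sumr_ge0// => j _.
  exact: q0.
have Q0 : 0 <= complex.Re (dsum_hdot v v).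
  by rewrite /dsum_hdot raddf_sum sumr_ge0// => j _; exact: q0.
rewrite -[mxop X v]/(mxapp X v) dsum_hdot_mxapp.
apply: (@le_trans _ _ (- (\sum_i \sum_j (M (i, j) *+ 2) *
    complex.Re (dsum_hdot v v)))).
  under [in leRHS]eq_bigr do rewrite -mulr_suml.
  by rewrite -mulr_suml mulNr lerN2 mulrDl mul1r lerDr.
rewrite [leRHS]raddf_sum -sumrN; apply: ler_sum => i _.
rewrite [leRHS]raddf_sum -sumrN.
apply: ler_sum => j _; have [Mij0 /(_ (v j) (v i))] := MP (i, j).
apply: le_trans; rewrite lerN2 mulrnAl -mulrnAr ler_wpM2l// mulr2n.
by rewrite lerD.
Qed.
End OperatorMatrices.

(** * The representation of a matrix ordered algebra *)

Lemma star_scaleAr (R : realType) (A : starAlgType R) (k : R[i]) (a b : A) :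
  k *: (a * b) = a * (k *: b).
Proof. exact: cscaleAr. Qed.

Lemma star_scaleAl (R : realType) (A : starAlgType R) (k : R[i]) (a b : A) :
  k *: (a * b) = (k *: a) * b.
Proof. exact: cscaleAl. Qed.

Definition cscalemx (R : realType) (A : starAlgType R) (k : R[i]) m n
  (X : 'M[A]_(m, n)) : 'M[A]_(m, n) := map_mx (fun a => k *: a) X.

(** The size is a field, so that one sum over all states covers every n. In contrast to states in
    the usual sense, these are not normalised. *)
Record state (R : realType) (A : starAlgType R) (C : forall n, set 'M[A]_n) :=
State {
  state_dim : nat;
  state_fun :> 'M[A]_state_dim -> R[i];
  state_dim_gt0 : (0 < state_dim)%N;
  state_linear : forall k X Y,
    state_fun (cscalemx k X + Y) = k * state_fun X + state_fun Y;
  state_adj : forall X, state_fun (adjmx X) = (state_fun X)^*;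
  state_ge0 : forall X, C state_dim X -> 0 <= state_fun X
}.

HB.instance Definition _ (R : realType) (A : starAlgType R) C :=
  gen_eqMixin (@state R A C).
HB.instance Definition _ (R : realType) (A : starAlgType R) C :=
  gen_choiceMixin (@state R A C).

(** * The direct sum of the row spaces of all states *)

Section StateSpace.
Variables (R : realType) (A : starAlgType R) (C : forall n, set 'M[A]_n).
Implicit Types (i : state C) (a b : A).

Lemma stateD i X Y : i (X + Y) = i X + i Y.
Proof.
have := state_linear (s := i) 1 X Y; rewrite mul1r => <-.
by congr (i (_ + _)); apply/matrixP => k l; rewrite mxE scale1r.
Qed.

Lemma state0 i : i 0 = 0.
Proof. by apply: (addrI (i 0)); rewrite -stateD !addr0. Qed.

Lemma state_sum i (I : Type) (r : seq I) (P : pred I) F :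
  i (\sum_(j <- r | P j) F j) = \sum_(j <- r | P j) i (F j).
Proof. by apply: big_morph; [exact: stateD|exact: state0]. Qed.

Definition finsupp : {pred state C -> nat -> A} :=
  fun x => `[< finite_set [set i | x i <> 0] >].

Lemma finsupp_submod : GRing.submod_closed finsupp.
Proof.
split=> [|k x y /asboolP xf /asboolP yf]; apply/asboolP.
  by suff -> : [set i | (0 : state C -> nat -> A) i <> 0] = set0 by [];
    apply/seteqP; split.
apply: (@sub_finite_set _ _ ([set i | x i <> 0] `|` [set i | y i <> 0])).
  move=> i /= xyi; apply: contrapT => /not_orP[/contrapT xi /contrapT yi].
  apply: xyi.
  have -> : (k *: x + y) i = k *: x i + y i by [].
  by rewrite xi yi scaler0 addr0.
by rewrite finite_setU.
Qed.

HB.instance Definition _ :=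
  GRing.isSubmodClosed.Build R[i] (state C -> nat -> A) finsupp finsupp_submod.

(* An element x consists of a row (x i 0, x i 1, ..) of length state_dim i for
   every state i; the entries beyond that length are null vectors. *)
Record rowsum := Rowsum {
  rowsum_fun :> state C -> nat -> A;
  rowsum_funP : rowsum_fun \in finsupp
}.

HB.instance Definition _ := [isSub for rowsum_fun].
HB.instance Definition _ := [Choice of rowsum by <:].
HB.instance Definition _ := [SubChoice_isSubLmodule of rowsum by <:].

Implicit Types x y z : rowsum.

Lemma rowsumP x y : x =2 y -> x = y.
Proof. by move=> xy; apply/val_inj/funext => i; apply/funext/xy. Qed.

Lemma rowsum_support m (x : 'I_m -> rowsum) :
  exists2 r : seq (state C), uniq r & forall p i, i \notin r -> x p i = 0.
Proof.
have /choice[r rP] : forall p, exists r : seq (state C),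
    forall i, i \notin r -> x p i = 0.
  move=> p; case: (x p) => f /= /asboolP/finite_seqP[r fr]; exists r => i ir.
  apply: contrapT => fi; move/negP: ir; apply.
  by have : [set i | f i <> 0] i by []; rewrite fr.
exists (undup (flatten [seq r p | p <- enum 'I_m])); first exact: undup_uniq.
move=> p i; rewrite mem_undup => ir; apply: (rP p); apply: contra ir => ir.
by apply/flattenP; exists (r p) => //; apply: map_f; rewrite mem_enum.
Qed.

Definition gram x y i : R[i] :=
  i (\matrix_(k, l) (star (y i k) * x i l)).

Definition rowsum_dot x y : R[i] := \sum_(i \in [set: state C]) gram x y i.

Lemma gram0 x y i : x i = 0 -> gram x y i = 0.
Proof.
move=> xi; rewrite /gram -[RHS](state0 i); congr (i _).
by apply/matrixP => k l; rewrite !mxE xi mulr0.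
Qed.

Lemma rowsum_dotE (r : seq (state C)) x y : uniq r ->
  (forall i, i \notin r -> x i = 0) ->
  rowsum_dot x y = \sum_(i <- r) gram x y i.
Proof.
move=> ru rP; rewrite /rowsum_dot (fsbigE r)//; last by move=> i _ /rP/gram0.
by apply: eq_bigl => i; exact: in_setT.
Qed.

Fact rowsum_dot_linear k x y z :
  rowsum_dot (k *: x + y) z = k * rowsum_dot x z + rowsum_dot y z.
Proof.
have [r ru rP] := rowsum_support (fun p : 'I_2 => if p == ord0 then x else y).
have rx i : i \notin r -> x i = 0 by move/(rP ord0).
have ry i : i \notin r -> y i = 0 by move/(rP (lift ord0 ord0)).
rewrite !(@rowsum_dotE r)//; last first.
  move=> i ir; have -> : (k *: x + y) i = k *: x i + y i by [].
  by rewrite rx// ry// scaler0 addr0.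
rewrite mulr_sumr -big_split; apply: eq_bigr => i _ /=.
rewrite -state_linear; congr (i _); apply/matrixP => p q; rewrite !mxE.
have -> : (k *: x + y) i q = k *: x i q + y i q by [].
by rewrite mulrDr -star_scaleAr.
Qed.

Fact rowsum_dotC x y : rowsum_dot x y = (rowsum_dot y x)^*.
Proof.
have [r ru rP] := rowsum_support (fun p : 'I_2 => if p == ord0 then x else y).
have rx i : i \notin r -> x i = 0 by move/(rP ord0).
have ry i : i \notin r -> y i = 0 by move/(rP (lift ord0 ord0)).
rewrite !(@rowsum_dotE r)// (rmorph_sum (conjc : {rmorphism _ -> _}))/=.
apply: eq_bigr => i _; rewrite /gram -state_adj; congr (i _).
by apply/matrixP => p q; rewrite !mxE starM starK.
Qed.

Lemma rowsum_act_subproof a x : (fun i k => a * x i k) \in finsupp.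
Proof.
case: x => x /= /asboolP xf; apply/asboolP; apply: sub_finite_set xf => i /= ax.
by contradict ax; apply/funext => k; rewrite ax mulr0.
Qed.

Definition rowsum_act a x := Rowsum (rowsum_act_subproof a x).

Lemma gram_act m (X : 'M[A]_m) (x : 'I_m -> rowsum) i :
  \sum_p \sum_q gram (rowsum_act (X p q) (x q)) (x p) i =
  i (adjmx (\matrix_(p < m, k < state_dim i) x p i k) *m X *m
    \matrix_(p < m, k < state_dim i) x p i k).
Proof.
under eq_bigr do rewrite -state_sum.
rewrite -state_sum; congr (i _); apply/matrixP => k l.
rewrite summxE !mxE; under [LHS]eq_bigr do rewrite summxE.
rewrite exchange_big.
apply: eq_bigr => q _; rewrite !mxE mulr_suml; apply: eq_bigr => p _.
by rewrite !mxE mulrA.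
Qed.

Lemma rowsum_act_ge0 m (X : 'M[A]_m) (x : 'I_m -> rowsum) :
  (forall n (B : 'M[A]_(m, n)), (0 < n)%N -> @C n (adjmx B *m X *m B)) ->
  0 <= \sum_p \sum_q rowsum_dot (rowsum_act (X p q) (x q)) (x p).
Proof.
move=> CX; have [r ru rP] := rowsum_support x.
have dotE p q : rowsum_dot (rowsum_act (X p q) (x q)) (x p) =
    \sum_(i <- r) gram (rowsum_act (X p q) (x q)) (x p) i.
  apply: rowsum_dotE => // i ir; apply/funext => k /=.
  by rewrite rP// mulr0.
under eq_bigr do (under eq_bigr do rewrite dotE; rewrite exchange_big).
rewrite exchange_big sumr_ge0// => i _.
rewrite gram_act; apply/state_ge0/CX/state_dim_gt0.
Qed.

End StateSpace.

Lemma adjmxK (R : realType) (A : starAlgType R) m n (X : 'M[A]_(m, n)) :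
  adjmx (adjmx X) = X.
Proof. by apply/matrixP => i j; rewrite !mxE starK. Qed.

Lemma adjmxD (R : realType) (A : starAlgType R) m n (X Y : 'M[A]_(m, n)) :
  adjmx (X + Y) = adjmx X + adjmx Y.
Proof. by apply/matrixP => i j; rewrite !mxE starD. Qed.

Lemma star0 (R : realType) (A : starAlgType R) : star 0 = 0 :> A.
Proof. by apply: (addrI (star 0)); rewrite -starD !addr0. Qed.

Lemma starN (R : realType) (A : starAlgType R) (a : A) : star (- a) = - star a.
Proof. by apply/eqP; rewrite -addr_eq0 -starD addNr star0. Qed.

Lemma adjmxN (R : realType) (A : starAlgType R) m n (X : 'M[A]_(m, n)) :
  adjmx (- X) = - adjmx X.
Proof. by apply/matrixP => i j; rewrite !mxE starN. Qed.

Lemma starZ_real (R : realType) (A : starAlgType R) (r : R) (a : A) :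
  star (r%:C *: a) = r%:C *: star a.
Proof. by rewrite [LHS]starZ /= oppr0. Qed.

Lemma adjmx1 (R : realType) (A : starAlgType R) n :
  adjmx 1%:M = 1%:M :> 'M[A]_n.
Proof.
apply/matrixP => i j; rewrite !mxE eq_sym.
by case: (i == j); rewrite ?star1 ?star0.
Qed.

(** * Separating states and the faithful representation *)

Section MatrixOrdered.
Variables (R : realType) (A : starAlgType R) (C : forall n, set 'M[A]_n).
Hypothesis Cord : matrix_ordered C.
Hypothesis Carch : archimedean_matrix_order_unit C.

Let C_sa n X : (0 < n)%N -> @C n X -> adjmx X = X.
Proof. by case: Cord => /(_ n) h _ _ _ n0 CX; case: (h n0) => /(_ _ CX). Qed.

Let C_cone n : (0 < n)%N -> is_cone (@C n).
Proof. by case: Cord => /(_ n) h _ _ _ n0; case: (h n0). Qed.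

Let C_congr n m (B : 'M[A]_(n, m)) X :
  (0 < n)%N -> (0 < m)%N -> @C n X -> @C m (adjmx B *m X *m B).
Proof. by case: Cord => _ _ _ h; exact: h. Qed.

Let C_unit n (X : 'M[A]_n) : (0 < n)%N -> adjmx X = X ->
  exists2 r : R, 0 < r & @C n (rscalemx r 1%:M + X).
Proof. by case: Carch => h _; exact: h. Qed.

(** The axioms put the unit into [C_1] only. For general n the order unit property at the zero
    matrix yields a positive multiple of e_n in [C_n], which is rescaled. *)
Lemma cone_one n : (0 < n)%N -> @C n 1%:M.
Proof.
move=> n0; have adj0 : adjmx 0 = 0 :> 'M[A]_n.
  by apply/matrixP => i j; rewrite !mxE star0.
have [r r0 Cr] := C_unit n0 adj0.
have ri : 0 <= r^-1 by rewrite invr_ge0 ltW.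
have := C_cone n0 ri (lexx 0) Cr Cr; congr (C _).
apply/matrixP => i j; rewrite !mxE scale0r !addr0 scalerA -rmorphM.
by rewrite mulVf ?lt0r_neq0// rmorph1 scale1r.
Qed.

Lemma cone_state n (X : 'M[A]_n) : (0 < n)%N -> adjmx X = X -> ~ @C n X ->
  exists2 G : 'M[A]_n -> R[i], ~ 0 <= G X &
    [/\ forall k Y Z, G (cscalemx k Y + Z) = k * G Y + G Z,
      forall Y, G (adjmx Y) = (G Y)^* & forall Y, @C n Y -> 0 <= G Y].
Proof.
move=> n0 Xsa CX.
have [r r0 CrX] : exists2 r : R, 0 < r & ~ @C n (rscalemx r 1%:M + X).
  apply: contrapT => h; apply: CX; case: Carch => _; apply=> // r r0.
  by apply: contrapT => CrX; apply: h; exists r.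
pose mx (f : 'I_n -> 'I_n -> A) : 'M[A]_n := \matrix_(i, j) f i j.
pose E : lmodType R[i] := 'I_n -> 'I_n -> A.
pose K : set E := [set f | @C n (mx f + adjmx (mx f))].
pose e : E := (1%:M : 'M[A]_n).
have mxK (Y : 'M[A]_n) : mx Y = Y by apply/matrixP => i j; rewrite mxE.
have addE (f g : E) i j : (f + g) i j = f i j + g i j by [].
have scaleE k (f : E) i j : (k *: f) i j = k *: f i j by [].
have eE i j : e i j = 1 *+ (i == j) by rewrite /e mxE.
have Kc : convex_cone K.
  move=> s t f g s0 t0 Kf Kg; have := C_cone n0 s0 t0 Kf Kg; congr (C _).
  apply/matrixP => i j; rewrite !mxE !addE !scaleE starD !starZ_real !scalerDr.
  by rewrite addrACA.
have Ke : K e.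
  have := C_cone n0 ler01 ler01 (cone_one n0) (cone_one n0); congr (C _).
  rewrite /e mxK adjmx1.
  by apply/matrixP => i j; rewrite !mxE !scale1r.
have Ku (f : E) : exists t : R, K (t%:C *: e + f).
  have [|t t0 Ct] := @C_unit n (mx f + adjmx (mx f)) n0.
    by rewrite adjmxD adjmxK addrC.
  (* Half of t, since the unit occurs both in the matrix and in its adjoint. *)
  exists (t / 2); rewrite /K /=; move: Ct; congr (C _).
  apply/matrixP => i j; rewrite !mxE !addE !scaleE starD starZ_real !eE.
  have -> : star (1 *+ (j == i)) = (1 *+ (i == j) : A).
    by rewrite eq_sym; case: (i == j); rewrite ?star1 ?star0.
  by rewrite addrACA -scalerDl -rmorphD; congr (_%:C *: _ + _); field.
(* The matrix being self-adjoint, membership in [K] would put twice r e_n + X into [C_n]; halving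
   contradicts the choice of r. *)
have KX : ~ K (r%:C *: e + (X : E)).
  rewrite /K /= => CX2; apply: CrX.
  have h : 0 <= 2^-1 :> R by rewrite invr_ge0.
  have := C_cone n0 h (lexx 0) CX2 CX2; congr (C _).
  have Y2 : mx (r%:C *: e + (X : E)) = rscalemx r 1%:M + X.
    by apply/matrixP => i j; rewrite !mxE addE scaleE eE.
  have Y2sa : adjmx (rscalemx r 1%:M + X) = rscalemx r 1%:M + X.
    rewrite adjmxD Xsa; congr (_ + _); rewrite -[in RHS]adjmx1.
    by apply/matrixP => i j; rewrite !mxE starZ_real.
  rewrite Y2 Y2sa; apply/matrixP => i j; rewrite !mxE scale0r addr0.
  move: (_ + X i j) => a; rewrite -[X in _ *: (X + X)]scale1r -scalerDl scalerA.
  rewrite -[RHS]scale1r; congr (_ *: _).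
  by rewrite -(rmorphD (real_complex R)) -rmorphM mulVf.
have [F [FD FZ F0 FX]] := cone_separation Kc Ke Ku r0 KX.
have FN (f : E) : F (- f) = - F f.
  have := FZ (-1) f; rewrite rmorphN1 scaleN1r => ->; exact: mulN1r.
have Fadj (Y : 'M[A]_n) : F (adjmx Y) = F Y.
  (* A skew-adjoint Z has Z + Z^* = 0 in [C_n]. Used for Y - Y^* and its negative, this makes F
     vanish there. *)
  have sk (Z : 'M[A]_n) : adjmx Z = - Z -> 0 <= F Z.
    move=> Zsk; apply: F0; rewrite /K /= mxK Zsk subrr.
    have := C_cone n0 (lexx 0) (lexx 0) (cone_one n0) (cone_one n0).
    by congr (C _); apply/matrixP => i j; rewrite !mxE scale0r addr0.
  have h1 := sk (Y - adjmx Y); have h2 := sk (adjmx Y - Y).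
  rewrite !adjmxD !adjmxN !adjmxK !opprB in h1 h2.
  have subE (Z W : 'M[A]_n) : F (Z - W : 'M[A]_n) = F Z - F W.
    rewrite -FN -FD; congr F; apply/funext => i; apply/funext => j.
    by rewrite !mxE.
  rewrite !subE in h1 h2.
  by have := h1 erefl; have := h2 erefl; lra.
pose iY (Y : 'M[A]_n) : 'M[A]_n := cscalemx 'i Y.
have FmxD (Y Z : 'M[A]_n) : F (Y + Z : 'M[A]_n) = F Y + F Z.
  by rewrite -FD; congr F; apply/funext => i; apply/funext => j; rewrite !mxE.
have FmxZ (t : R) (Y : 'M[A]_n) : F (cscalemx t%:C Y) = t * F Y.
  by rewrite -FZ; congr F; apply/funext => i; apply/funext => j; rewrite !mxE.
have FmxC a b (Y : 'M[A]_n) : F (cscalemx (a +i* b) Y) = a * F Y + b * F (iY Y).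
  rewrite -!FmxZ -FmxD; congr F; apply/funext => i; apply/funext => j.
  rewrite !mxE scalerA -scalerDl; congr (_ *: _).
  by apply/eqP; rewrite eq_complex /=; apply/andP; split; apply/eqP; ring.
(* The complex linear functional with real part F. It is real on self-adjoint Y because F(iY)
   changes sign when Y is replaced by its adjoint. *)
pose G (Y : 'M[A]_n) : R[i] := F Y +i* - F (iY Y).
have FiY Y : F (iY (adjmx Y)) = - F (iY Y).
  have -> : iY (adjmx Y) = adjmx (cscalemx (0 +i* -1) Y).
    apply/matrixP => i j; rewrite !mxE [star (_ *: _)]starZ.
    by congr (_ *: _); rewrite /= opprK.
  by rewrite Fadj FmxC; lra.
exists G; first by rewrite lecE /= => /andP[_]; rewrite leNgt FX.
split.
- move=> [a b] Y Z; apply/eqP; rewrite eq_complex /=.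
  rewrite !FmxD (FmxC a b).
  have -> : iY (cscalemx (a +i* b) Y + Z) = cscalemx (- b +i* a) Y + iY Z.
    apply/matrixP => i j; rewrite !mxE scalerDr scalerA; congr (_ *: _ + _).
    by apply/eqP; rewrite eq_complex /=; apply/andP; split; apply/eqP; ring.
  by rewrite FmxD (FmxC (- b) a); apply/andP; split; apply/eqP; ring.
- move=> Y; apply/eqP; rewrite eq_complex /= Fadj FiY.
  by rewrite !eqxx.
- move=> Y CY; rewrite lecE /=; apply/andP; split; last first.
    apply: F0; rewrite /K /= mxK (C_sa n0 CY).
    have := C_cone n0 ler01 ler01 CY CY; congr (C _).
    by apply/matrixP => i j; rewrite !mxE !scale1r.
  by have := FiY Y; rewrite (C_sa n0 CY) => ?; apply/eqP; lra.
Qed.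

Lemma cone_act_ge0 m (X : 'M[A]_m) (x : 'I_m -> rowsum C) : (0 < m)%N ->
  @C m X -> 0 <= \sum_p \sum_q rowsum_dot (rowsum_act (X p q) (x q)) (x p).
Proof. by move=> m0 CX; apply: rowsum_act_ge0 => n B n0; exact: C_congr. Qed.

Lemma rowsum_act1 (x : rowsum C) : rowsum_act 1 x = x.
Proof. by apply: rowsumP => i k; exact: mul1r. Qed.

Lemma rowsum_actM a b (x : rowsum C) :
  rowsum_act (a * b) x = rowsum_act a (rowsum_act b x).
Proof. by apply: rowsumP => i k; rewrite /= mulrA. Qed.

Lemma rowsum_act_linl (k : R[i]) a b (x : rowsum C) :
  rowsum_act (k *: a + b) x = k *: rowsum_act a x + rowsum_act b x.
Proof. by apply: rowsumP => i l /=; rewrite mulrDl -star_scaleAl. Qed.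

Lemma rowsum_act_linr a (k : R[i]) (x y : rowsum C) :
  rowsum_act a (k *: x + y) = k *: rowsum_act a x + rowsum_act a y.
Proof.
apply: rowsumP => i l; rewrite -[LHS]/(a * (k *: x i l + y i l)).
by rewrite -[RHS]/(k *: (a * x i l) + a * y i l) mulrDr -star_scaleAr.
Qed.

Fact rowsum_dot_Re_ge0 (x : rowsum C) : 0 <= complex.Re (rowsum_dot x x).
Proof.
have := cone_act_ge0 (fun=> x) (ltn0Sn 0) (cone_one (ltn0Sn 0)).
by rewrite !big_ord1 mxE eqxx rowsum_act1 lecE => /andP[].
Qed.

Definition rowsum_semidot :=
  Semidot (@rowsum_dot_linear R A C) (@rowsum_dotC R A C) rowsum_dot_Re_ge0.

Lemma rowsum_act_star a (x y : rowsum C) :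
  rowsum_semidot (rowsum_act a x) y = rowsum_semidot x (rowsum_act (star a) y).
Proof.
apply: eq_fsbigr => i _; congr (i _); apply/matrixP => k l.
by rewrite !mxE starM starK mulrA.
Qed.

Lemma rowsum_act_bounded a : exists M : R, forall x : rowsum C,
  nrm rowsum_semidot (rowsum_act a x) <= M * nrm rowsum_semidot x.
Proof.
pose Y : 'M[A]_1 := - (star a * a)%:M.
have Ysa : adjmx Y = Y.
  apply/matrixP => i j; rewrite !ord1 !mxE eqxx !mulr1n.
  by rewrite starN starM starK.
have [r r0 CY] := C_unit (ltn0Sn 0) Ysa.
exists (Num.sqrt r) => x; have := cone_act_ge0 (fun=> x) (ltn0Sn 0) CY.
rewrite !big_ord1 !mxE eqxx mulr1n rowsum_act_linl rowsum_act1.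
have -> : rowsum_act (- (star a * a)) x = - rowsum_act (star a * a) x.
  by apply: rowsumP => i k; exact: mulNr.
rewrite -[rowsum_dot _ _]/(rowsum_semidot _ _) sdotBl sdotZl rowsum_actM.
rewrite rowsum_act_star starK !sdotxx -rmorphM -rmorphB ler0c subr_ge0 => h.
by rewrite /nrm -sqrtrM ?(ltW r0)//; exact: ler_wsqrtr.
Qed.

Lemma matrix_ordered_representation :
  exists (H : hilbertType R) (tau : A -> bop H),
    [/\ star_representation tau, tau 1 = 1, injective tau &
        forall n, (0 < n)%N ->
          [set map_mx tau X | X in @C n] = mxpos (range tau) n].
Proof.
have [H [tau [tauS tau1 tauP]]] := completion_representation
  rowsum_act_linl rowsum_act_linr rowsum_actM rowsum_act1 rowsum_act_star
  rowsum_act_bounded.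
have [tau_lin tauM tau_star] := tauS.
have tau0 : tau 0 = 0.
  by have := tau_lin (-1) 0 0; rewrite scaler0 addr0 scaleN1r addNr.
have tauB a b : tau (a - b) = tau a - tau b.
  by rewrite addrC -scaleN1r tau_lin scaleN1r addrC.
have tau_pos n (X : 'M[A]_n) : (0 < n)%N -> adjmx X = X ->
    mxop_positive (map_mx tau X) -> @C n X.
  move=> n0 Xsa /tauP Xpos; apply: contrapT => CX.
  have [G GX [G1 G2 G3]] := cone_state n0 Xsa CX.
  pose st := State n0 G1 G2 G3.
  (* The p-th unit row, placed in the summand of the separating state alone; stacked, these rows
     form the identity matrix. *)
  pose f (p : 'I_n) (i : state C) (k : nat) : A :=
    if (i == st) && (k == p :> nat) then 1 else 0.
  have fP p : f p \in @finsupp R A C.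
    apply/asboolP; apply: (@sub_finite_set _ _ [set st]) => // i /= fi.
    apply: contrapT => ist; apply: fi; apply/funext => k; rewrite /f.
    by case: eqP ist.
  apply: GX; have := Xpos (fun p => Rowsum (fP p)).
  have dotE p q : rowsum_semidot (rowsum_act (X p q) (Rowsum (fP q)))
      (Rowsum (fP p)) = gram (rowsum_act (X p q) (Rowsum (fP q)))
      (Rowsum (fP p)) st.
    rewrite /= (@rowsum_dotE _ _ _ [:: st])// ?big_seq1// => i.
    rewrite inE => /negPf ist; apply/funext => k.
    by rewrite /= /f ist mulr0.
  under eq_bigr do under eq_bigr do rewrite dotE.
  rewrite gram_act; have -> : \matrix_(p < n, k < n) f p st k = 1%:M :> 'M[A]_n.
    apply/matrixP => p k; rewrite !mxE /f eqxx /= -[p == k]val_eqE eq_sym /=.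
    by case: (p == k :> nat).
  by rewrite adjmx1 mul1mx mulmx1.
(* A self-adjoint h in the kernel has h and -h in [C_1], so h = 0. For any a in the kernel, a + a^*
   is of this kind, hence a is skew-adjoint, and then ia is of this kind too. *)
have tau_inj : injective tau.
  move=> a b ab; apply/eqP; rewrite -subr_eq0; apply/eqP.
  have : tau (a - b) = 0 by rewrite tauB ab subrr.
  move: (a - b) => {b ab} {}a a0.
  have pos0 h : star h = h -> tau h = 0 -> @C 1%N h%:M.
    move=> hsa h0; apply: tau_pos => //.
      by apply/matrixP => i j; rewrite !ord1 !mxE eqxx mulr1n.
    move=> v; rewrite /dsum_hdot /mxop !big_ord1 !mxE eqxx mulr1n h0.
    by rewrite -[X in hdot X _]/(0 : H) hdot0l.
  have sa0 h : star h = h -> tau h = 0 -> h = 0.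
    move=> hsa h0; have [_ _ /(_ 1%N (ltn0Sn 0)) CN _] := Cord.
    have : (@C 1%N `&` [set - X | X in @C 1%N]) h%:M.
      split; first exact: pos0.
      exists ((- h)%:M); last by rewrite raddfN opprK.
      by apply: pos0; rewrite ?starN ?hsa// -sub0r tauB h0 tau0 subrr.
    by rewrite CN => /matrixP/(_ ord0 ord0); rewrite !mxE eqxx mulr1n.
  have star0H : star (0 : bop H) = 0 by exact: star0.
  have aN : star a = - a.
    apply/eqP; rewrite -addr_eq0; apply/eqP/sa0.
      by rewrite starD starK addrC.
    have := tau_lin 1 (star a) a; rewrite !scale1r => ->.
    by rewrite tau_star a0 star0H addr0.
  have ia : 'i *: a = 0.
    apply: sa0.
      rewrite [LHS]starZ -[LHS]/('i^* *: star a) aN scalerN -scaleNr.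
      by congr (_ *: _); apply/eqP; rewrite eq_complex /= oppr0 opprK !eqxx.
    have := tau_lin 'i a 0; rewrite !addr0 => ->.
    by rewrite a0 scaler0 add0r.
  rewrite -[a]scale1r -[1]opprK -(sqr_i R) expr2 -mulNr -scalerA ia.
  exact: scaler0.
exists H, tau; split=> // n n0; apply/seteqP; split=> [_ [X CX <-]|Y [Yr Ypos]].
  split=> [i j|]; first by rewrite mxE; exists (X i j).
  by apply/tauP => w; exact: cone_act_ge0.
have /choice[X XP] : forall ij : 'I_n * 'I_n, exists a, tau a = Y ij.1 ij.2.
  by move=> [i j]; have [a _ <-] := Yr i j; exists a.
have XY : map_mx tau (\matrix_(i, j) X (i, j)) = Y.
  by apply/matrixP => i j; rewrite !mxE XP.
(* The entrywise preimage must be self-adjoint before [tau_pos] applies: the positive Y is, and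
   injectivity carries this back. *)
exists (\matrix_(i, j) X (i, j)) => //; apply: tau_pos; rewrite ?XY//.
apply/matrixP => i j; apply: tau_inj.
have /matrixP/(_ i j) := mxop_positive_adjmx Ypos.
by rewrite -XY !mxE tau_star !XP.
Qed.
End MatrixOrdered.

(** * Subalgebras of B(H) *)

Lemma dsum_hdotC (R : realType) (H : hilbertType R) n (v w : 'I_n -> H) :
  dsum_hdot v w = (dsum_hdot w v)^*.
Proof.
rewrite /dsum_hdot (rmorph_sum (@conjc R)).
by apply: eq_bigr => i _; exact: hdotC.
Qed.

Lemma dsum_hdot_ge0 (R : realType) (H : hilbertType R) n (v : 'I_n -> H) :
  0 <= dsum_hdot v v.
Proof. by rewrite sumr_ge0// => i _; rewrite hdot_norm exprn_ge0. Qed.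

Section Subalgebra.
Variables (R : realType) (H : hilbertType R) (D : unitalStarSubalg (bop H)).
Local Notation opmx X := (map_mx (@ssa_val R (bop H) D) X).

Lemma opmx_inj m n : injective (fun X : 'M[subalg D]_(m, n) => opmx X).
Proof.
move=> X Y /matrixP XY; apply/matrixP => i j; apply: val_inj.
by have := XY i j; rewrite !mxE.
Qed.

Lemma opmx_adj m n (X : 'M[subalg D]_(m, n)) : opmx (adjmx X) = adjmx (opmx X).
Proof. by apply/matrixP => i j; rewrite !mxE. Qed.

Lemma opmx_mul m n p (X : 'M[subalg D]_(m, n)) (Y : 'M_(n, p)) :
  opmx (X *m Y) = opmx X *m opmx Y.
Proof.
apply/matrixP => i j; rewrite !mxE (big_morph (@ssa_val R (bop H) D)
  (id1 := 0) (op1 := +%R))//.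
by apply: eq_bigr => k _; rewrite !mxE.
Qed.

Definition qform n (X : 'M[subalg D]_n) w := dsum_hdot (mxapp (opmx X) w) w.

Lemma qformD n (X Y : 'M[subalg D]_n) w :
  qform (X + Y) w = qform X w + qform Y w.
Proof.
rewrite /qform !dsum_hdot_mxapp -big_split; apply: eq_bigr => i _ /=.
by rewrite -big_split; apply: eq_bigr => j _; rewrite !mxE /= -hdotDl.
Qed.

Lemma qformZ n (X : 'M[subalg D]_n) r w :
  qform (rscalemx r X) w = r%:C * qform X w.
Proof.
rewrite /qform !dsum_hdot_mxapp mulr_sumr; apply: eq_bigr => i _ /=.
by rewrite mulr_sumr; apply: eq_bigr => j _; rewrite !mxE /= -hdotZl.
Qed.

Lemma qform_congr m n (B : 'M[subalg D]_(m, n)) (X : 'M_m) w :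
  qform (adjmx B *m X *m B) w = qform X (mxapp (opmx B) w).
Proof. by rewrite /qform !opmx_mul opmx_adj -mulmxA !mxapp_mul mxapp_adj. Qed.

(** The unit of D is a self-adjoint idempotent, so its form is that of a projection, even where it
    differs from the identity of H. *)
Lemma qform1 n w :
  qform 1%:M w = dsum_hdot (mxapp (opmx (1%:M : 'M_n)) w)
                           (mxapp (opmx (1%:M : 'M_n)) w).
Proof.
by rewrite /qform -{1}[1%:M]mulmx1 -{1}[1%:M]adjmx1 opmx_mul opmx_adj mxapp_mul
  mxapp_adj.
Qed.

Lemma qform_selfadj n (X : 'M[subalg D]_n) w :
  adjmx X = X -> complex.Im (qform X w) = 0.
Proof.
move=> Xsa; have : qform X w = (qform X w)^*.
  by rewrite -dsum_hdotC -mxapp_adj -opmx_adj Xsa.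
by case: (qform X w) => a b [] /=; lra.
Qed.

(** As X = e_n X e_n, both terms depend on w only through e_n w; this is the form in which lower
    bounds for X are compared with the unit. *)
Lemma qform_unit_split n (X : 'M[subalg D]_n) r w :
  qform (rscalemx r 1%:M + X) w =
  r%:C * qform 1%:M w + qform X (mxapp (opmx (1%:M : 'M_n)) w).
Proof. by rewrite qformD qformZ -qform_congr adjmx1 mul1mx mulmx1. Qed.

Let C n : set 'M[subalg D]_n :=
  [set X : 'M[subalg D]_n | mxpos (ssa_set D) n (opmx X)].

(** Matrices over [subalg D] have their entries in D by construction, which leaves only the
    quadratic form to test. *)
Let CP n (X : 'M[subalg D]_n) : @C n X <-> forall w, 0 <= qform X w.
Proof.
split=> [[_]//|Xpos]; split=> // i j; rewrite mxE; exact: ssa_valD.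
Qed.

Lemma subalg_matrix_ordered : matrix_ordered C.
Proof.
have scale0mx n (X : 'M[subalg D]_n) : rscalemx 0 X = 0.
  by apply/matrixP => i j; rewrite !mxE scale0r.
split.
- move=> n n0; split.
    move=> X [_ /mxop_positive_adjmx Xsa].
    by apply: opmx_inj; rewrite opmx_adj.
  move=> r s X Y r0 s0 /CP X0 /CP Y0.
  by apply/CP => w; rewrite qformD !qformZ addr_ge0// mulr_ge0// ler0c.
- by apply/CP => w; rewrite qform1 dsum_hdot_ge0.
- move=> n n0; apply/seteqP; split=> [X [/CP X0 [Y /CP Y0 YX]]|_ ->] /=.
    apply: opmx_inj; rewrite [RHS](_ : _ = 0); last first.
      by apply/matrixP => i j; rewrite !mxE.
    apply: mxop_zero => w; apply/le_anti/andP; split; last exact: X0.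
    have : qform X w + qform Y w = 0.
      by rewrite -qformD -YX addNr -(scale0mx _ X) qformZ mul0r.
    move/eqP; rewrite addr_eq0 => /eqP; rewrite /qform => ->.
    by rewrite oppr_le0; exact: Y0.
  have C0 : @C n 0 by apply/CP => w; rewrite -(scale0mx _ 0) qformZ mul0r.
  by split=> //; exists 0; rewrite ?oppr0.
- by move=> n m B X n0 m0 /CP X0; apply/CP => w; rewrite qform_congr.
Qed.

Lemma subalg_archimedean : archimedean_matrix_order_unit C.
Proof.
split=> [n X n0 Xsa|n X n0 Xsa CX].
  have [r r0 rX] := mxop_lower_bound (opmx X); exists r => //; apply/CP => w.
  rewrite qform_unit_split qform1; set v := mxapp _ w.
  have := rX v; have := dsum_hdot_ge0 v; have := qform_selfadj v Xsa.
  rewrite -[mxop _ _]/(mxapp (opmx X) v) -/(qform X v) !lecE.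
  case: (qform X v) (dsum_hdot v v) => a b [c d] /= -> /andP[/eqP -> _] h.
  by rewrite !(mul0r, mulr0, addr0, subr0, eqxx)/=; lra.
apply/CP => w; rewrite -[X]mul1mx -[_ *m X]mulmx1 -{1}[1%:M]adjmx1 qform_congr.
have {}CX (r : R) : 0 < r -> 0 <= r%:C * qform 1%:M w +
    qform X (mxapp (opmx (1%:M : 'M_n)) w).
  by move=> /CX/CP/(_ w); rewrite qform_unit_split.
have : 0 <= qform (1%:M : 'M[subalg D]_n) w by rewrite qform1 dsum_hdot_ge0.
move: (qform 1%:M w) (qform X _) CX => [a a'] [b b'] CX; rewrite !lecE /=.
move=> /andP[/eqP a'0 a0]; move: a'0 CX => -> CX; apply/andP; split.
  (* Nonnegativity in [R[i]] includes being real; r = 1 already yields this. *)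
  by have := CX 1 ltr01; rewrite lecE /= => /andP[/eqP h _]; apply/eqP; lra.
apply/ler_addgt0Pr => e e0.
(* The form a of the unit at w may be 0, hence the denominator a + 1; multiplying by a still gives
   at most e. *)
have e1 : 0 < e / (a + 1) by rewrite divr_gt0//; lra.
have := CX _ e1; rewrite lecE /= => /andP[_] h.
have : e / (a + 1) * a <= e by rewrite mulrAC ler_pdivrMr; nra.
by lra.
Qed.
End Subalgebra.

Theorem theorem2 (R : realType) :
  (forall (A : starAlgType R) (C : forall n, set 'M[A]_n),
     matrix_ordered C -> archimedean_matrix_order_unit C ->
     exists (H : hilbertType R) (tau : A -> bop H),
       [/\ star_representation tau, tau 1 = 1, injective tau &
           forall n, (0 < n)%N ->
             [set map_mx tau X | X in C n] = mxpos (range tau) n]) /\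
  (forall (H : hilbertType R) (D : unitalStarSubalg (bop H)),
     let C n : set 'M[subalg D]_n :=
       [set X : 'M[subalg D]_n | mxpos (ssa_set D) n (map_mx val X)] in
     matrix_ordered C /\ archimedean_matrix_order_unit C).
Proof.
split=> [A C Cord Carch|H D].
  exact: matrix_ordered_representation.
by split; [exact: subalg_matrix_ordered|exact: subalg_archimedean].
Qed.
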